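(* Suppose the variety $Z(l,d,r;V)$ is not empty. Then $Z(l,d,r;V)$ is irreducible unless $\langle\cdot,\cdot\rangle$ is symmetric, $2d=n$ and $l=d$. In the exceptional case, $Z(l,d,r;V)$ consists of exactly two irreducible components.
   Context: $k$ is an algebraically closed field of characteristic different from $2$; $n,r$ are positive integers; $V=k^n$ is equipped with a nondegenerate bilinear form $\langle\cdot,\cdot\rangle$ that is either symmetric or skew-symmetric; $d,l$ are integers with $1\le d\le n-1$ and $0\le l\le d$. $\rho$ is the adjoint involution on $\mathrm{End}_k(V)$, determined by $\langle\rho(A)v,w\rangle=\langle v,Aw\rangle$ for all $v,w\in V$. For a subspace $W\subseteq V$, $W^\perp=\{x\in V\mid \langle w,x\rangle=0\ \forall w\in W\}$ and the isotropy rank of $W$ is $\dim_k(W\cap W^\perp)$. For $A_\bullet=(A_1,\dots,A_r)\in\mathrm{End}_k(V)^r$, $W$ is $\rho$-invariant under $A_\bullet$ if $A_iW\subseteq W$ and $\rho(A_i)W\subseteq W$ for all $i$. $Z(\ge l,d,r;V)$ is the set of $A_\bullet\in\mathrm{End}_k(V)^r$ having some $\rho$-invariant subspace of dimension $d$ and isotropy rank at least $l$; it is Zariski closed. $Z(l,d,r;V)=Z(\ge l,d,r;V)\setminus Z(\ge l+1,d,r;V)$. Everything carries the Zariski topology. *)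

(* Defs.v *)
From HB Require Import structures.
From mathcomp Require Import all_boot all_algebra sesquilinear.
From mathcomp Require Import boolp classical_sets.
From mathcomp Require mpoly.

Set Implicit Arguments.
Unset Strict Implicit.
Unset Printing Implicit Defensive.

Import GRing.Theory.
Local Open Scope ring_scope.
Local Open Scope classical_set_scope.

(* A form of type {hermitian 'rV[k]_n for eps & idfun} is a bilinear form with
   form u v = (-1) ^+ eps * form v u: symmetric if eps = false, skew-symmetric
   if eps = true. *)
Section AdjointInvolution.
Variables (k : fieldType) (n : nat) (eps : bool).
Variable form : {hermitian 'rV[k]_n for eps & idfun}.
Implicit Types (A B : 'End('rV[k]_n)) (W : {vspace 'rV[k]_n}).

(* If v, w are row vectors, G is the Gram matrix of the form and A is
   w |-> w *m M, then form v (A w) = v *m G *m M^T *m w^T, so that the matrix R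
   of rho A must satisfy R *m G = G *m M^T. *)
Definition rho A : 'End('rV[k]_n) :=
  let G := matrix_of_form form in
  linfun (mulmxr (G *m (lin1_mx A)^T *m invmx G)).

Lemma formE v w : form v w = (v *m matrix_of_form form *m w^T) 0 0.
Proof.
have -> : form v w = form_of_matrix idfun (matrix_of_form form) v w.
  by rewrite matrix_of_formK.
by rewrite /form_of_matrix trace_mx11 map_mx_id.
Qed.

Lemma nondegenerateP :
  reflect (forall v, (forall w, form v w = 0) -> v = 0) (nondegenerate form).
Proof.
rewrite /nondegenerate -subv0; apply: (iffP subvP) => [nd v v0 | nd v].
  by apply/eqP; rewrite -memv0 nd //; apply/mem_orthovP => w _.
by move/mem_orthovP=> v0; rewrite memv0 (nd v) // => w; rewrite v0 ?memvf.
Qed.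

Lemma gram_unit : nondegenerate form -> matrix_of_form form \in unitmx.
Proof.
move/nondegenerateP=> nd; rewrite -row_free_unit -kermx_eq0.
apply/eqP/row_matrixP=> i; rewrite row0; apply: nd => w.
by rewrite formE -row_mul mulmx_ker row0 mul0mx mxE.
Qed.

Lemma rhoP A : nondegenerate form ->
  forall v w, form (rho A v) w = form v (A w).
Proof.
move=> /gram_unit Gu v w; rewrite !formE lfunE /= !mulmxA mulmxKV //.
by rewrite -(mul_rV_lin1 A) trmx_mul !mulmxA.
Qed.

Lemma rho_unique A B : nondegenerate form ->
  (forall v w, form (B v) w = form v (A w)) -> B = rho A.
Proof.
move=> nd adjB; apply/lfunP=> v; apply/eqP; rewrite -subr_eq0; apply/eqP.
move/nondegenerateP: (nd); apply=> w.
by rewrite linearBl /= adjB rhoP // subrr.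
Qed.

Definition isotropy_rank W : nat := \dim (W :&: orthov form W)%VS.

Definition rho_invariant r (A : {ffun 'I_r -> 'End('rV[k]_n)}) W : Prop :=
  forall i, (A i @: W <= W)%VS /\ (rho (A i) @: W <= W)%VS.

Definition Zge (l d r : nat) : set {ffun 'I_r -> 'End('rV[k]_n)} :=
  [set A | exists W : {vspace 'rV[k]_n},
     [/\ rho_invariant A W, \dim W = d & (l <= isotropy_rank W)%N]].
Arguments Zge : clear implicits.

Definition Zeq (l d r : nat) : set {ffun 'I_r -> 'End('rV[k]_n)} :=
  Zge l d r `\` Zge l.+1 d r.

End AdjointInvolution.

Arguments Zge {k n eps} form l d r _.
Arguments Zeq {k n eps} form l d r _.

Section ZariskiTopology.
Variables (k : fieldType) (n r : nat).
Local Notation T := {ffun 'I_r -> 'End('rV[k]_n)}.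
Local Notation N := #|{: 'I_r * 'I_n * 'I_n}|.
Implicit Types (A : T) (Y C D : set T).

(* The N = r * n * n matrix entries of A, in the order of the enumeration of
   the triples (i, a, b). *)
Definition entries A (c : 'I_N) : k :=
  let: (i, a, b) := enum_val c in (A i (delta_mx 0 a)) 0 b.

Definition zariski_closed C : Prop :=
  exists S : set (mpoly.mpoly N k),
    C = [set A | forall p, S p -> mpoly.meval (entries A) p = 0].

Definition zariski_closed_in Y C : Prop :=
  exists2 D, zariski_closed D & C = Y `&` D.

Definition irreducible Y : Prop :=
  Y !=set0 /\
  forall C1 C2, zariski_closed_in Y C1 -> zariski_closed_in Y C2 ->
    Y = C1 `|` C2 -> Y = C1 \/ Y = C2.

Definition irreducible_component Z Y : Prop :=
  [/\ Y `<=` Z, irreducible Y &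
      forall Y', Y' `<=` Z -> irreducible Y' -> Y `<=` Y' -> Y' = Y].

End ZariskiTopology.

(* Main.v *)
From HB Require Import structures.
Require Import Defs.
From mathcomp Require Import all_boot all_algebra sesquilinear.
From mathcomp Require Import boolp classical_sets functions filter.
From mathcomp Require Import ring zify.
From mathcomp Require Import (canonicals) mpoly.

(** Why the theorem holds.

    Fix a subspace W and let E_W be the linear space of all tuples A that
    leave W invariant under every A_i and rho A_i. The stratum is the union of
    the E_W over the W of dimension d and isotropy rank l, minus the tuples
    that also have an invariant subspace of larger isotropy rank. By Witt's
    theorem the isometry group permutes these W transitively, so the stratum
    is swept out by a group acting on a linear space, and its irreducible
    components come from the components of the group.

    Irreducibility is obtained from curves: a set is irreducible as soon as
    any two of its points are joined by a polynomial curve almost all of whose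
    points lie in the set (irreducible_of_curves). Given y1 in E_W and y2 in
    E_W', Witt's theorem in the constructive form witt_subspaces provides a
    product g of reflections or transvections with W' = W g. Each factor can
    be deformed polynomially: a transvection to the identity, a reflection to
    any other reflection. Hence g is joined to a power of a fixed h
    (word_path), and if h stabilizes W this deforms E_W into E_W'
    (path_curve). For a skew form take h = 1. For a symmetric form take the
    reflection in an anisotropic vector of W or of its orthogonal; such a
    vector exists unless W is its own orthogonal (stabilizing_base), which is
    the exceptional case. Along the curve the isotropy rank of the moving
    subspace stays equal to l; that no larger rank occurs at the general point
    follows because Zge is Zariski closed (Zge_closed).

    Closedness is the completeness of the Grassmannian. The argument is the
    valuative one. If A lies in the closure of Y, an ultrafilter on Y along
    which every polynomial nonzero at A is nonzero makes A a specialization of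
    the generic point of Y: polynomial functions have a limit, their value at
    A. Chevalley's extension of places (place_extension) gives a limit to one
    more function or to its inverse, so among the maximal minors of the
    invariant subspaces W_y one can be chosen that divides the others, and the
    W_y have a limit subspace of the same dimension (grassmannian_limit).
    Algebraic identities pass to the limit.

    In the exceptional case the subspaces are Lagrangian. An isometry that
    stabilizes a Lagrangian has determinant 1 (det_lagrangian_stabilizer), so
    Lagrangians fall into two families, according to the determinant of an
    isometry carrying a fixed one to them. Each family sweeps out an
    irreducible set, by words of even length, which are joined to the
    identity. Each of these sets is closed: if N is the limit of the W_y and L
    a Lagrangian complement of N, then L is also a complement of some W_y, and
    the isometry fixing L that carries W_y to N has determinant 1. Neither set
    contains the other, because a regular nilpotent matrix adapted to a
    Lagrangian M has M as its only invariant subspace of dimension d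
    (nilpotent_with_unique_subspace). *)

Set Implicit Arguments.
Unset Strict Implicit.
Unset Printing Implicit Defensive.

Import GRing.Theory.
Local Open Scope ring_scope.
Local Open Scope classical_set_scope.

(** * Algebras of functions *)

Section FunctionAlgebra.
Variables (k : fieldType) (X : Type).
Implicit Types (f g : X -> k).

(** Used for two algebras: the polynomial functions of one parameter, and the
    functions that possess a limit at a place.  Matrix operations are then
    inherited entry by entry. *)
Record function_algebra (R : (X -> k) -> Prop) : Prop := FunctionAlgebra {
  fun_cst : forall c, R (fun _ => c);
  fun_add : forall f g, R f -> R g -> R (fun x => f x + g x);
  fun_mul : forall f g, R f -> R g -> R (fun x => f x * g x) }.

Definition entrywise (R : (X -> k) -> Prop) m n (M : X -> 'M[k]_(m, n)) :=
  forall i j, R (fun x => M x i j).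

Variable R : (X -> k) -> Prop.
Hypothesis algR : function_algebra R.

Lemma fun_sum (I : Type) (s : seq I) (P : pred I) (F : I -> X -> k) :
  (forall i, R (F i)) -> R (fun x => \sum_(i <- s | P i) F i x).
Proof.
move=> RF; elim: s => [|i s IHs].
  by under eq_fun do rewrite big_nil; apply: (fun_cst algR).
under eq_fun do rewrite big_cons; case: (P i) => //.
exact: (fun_add algR).
Qed.

Lemma fun_prod (I : Type) (s : seq I) (P : pred I) (F : I -> X -> k) :
  (forall i, R (F i)) -> R (fun x => \prod_(i <- s | P i) F i x).
Proof.
move=> RF; elim: s => [|i s IHs].
  by under eq_fun do rewrite big_nil; apply: (fun_cst algR).
under eq_fun do rewrite big_cons; case: (P i) => //.
exact: (fun_mul algR).
Qed.

Lemma entrywise_cst m n (M : 'M[k]_(m, n)) : entrywise R (fun=> M).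
Proof. by move=> i j; apply: (fun_cst algR). Qed.

Lemma entrywise_add m n (M N : X -> 'M[k]_(m, n)) :
  entrywise R M -> entrywise R N -> entrywise R (fun x => M x + N x).
Proof.
by move=> RM RN i j; under eq_fun do rewrite mxE; apply: (fun_add algR).
Qed.

Lemma entrywise_scale m n f (M : X -> 'M[k]_(m, n)) :
  R f -> entrywise R M -> entrywise R (fun x => f x *: M x).
Proof.
by move=> Rf RM i j; under eq_fun do rewrite mxE; apply: (fun_mul algR).
Qed.

Lemma entrywise_tr m n (M : X -> 'M[k]_(m, n)) :
  entrywise R M -> entrywise R (fun x => (M x)^T).
Proof. by move=> RM i j; under eq_fun do rewrite mxE; apply: RM. Qed.

Lemma entrywise_mul m n p (M : X -> 'M[k]_(m, n)) (N : X -> 'M[k]_(n, p)) :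
  entrywise R M -> entrywise R N -> entrywise R (fun x => M x *m N x).
Proof.
move=> RM RN i j; under eq_fun do rewrite mxE.
apply: (@fun_sum _ _ _ (fun l x => M x i l * N x l j)) => l.
exact: (fun_mul algR (RM i l) (RN l j)).
Qed.

Lemma entrywise_colsub m n p (h : 'I_p -> 'I_n) (M : X -> 'M[k]_(m, n)) :
  entrywise R M -> entrywise R (fun x => colsub h (M x)).
Proof. by move=> RM i j; under eq_fun do rewrite mxE; apply: RM. Qed.

Lemma fun_det n (M : X -> 'M[k]_n) :
  entrywise R M -> R (fun x => \det (M x)).
Proof.
move=> RM; apply: fun_sum => s; apply: (fun_mul algR);
  first exact: (fun_cst algR).
exact: fun_prod.
Qed.

End FunctionAlgebra.

(** * Extension of places *)

Section Places.
Variables (k : closedFieldType) (T : choiceType).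
Variables (U : set_system T) (UU : UltraFilter U).
Implicit Types (R : (option T -> k) -> Prop) (f : option T -> k) (x z : T -> k).

(** A function on option T is a function on T together with its limit, stored
    at None. *)
Definition extend x (c : k) : option T -> k :=
  fun o => if o is Some y then x y else c.

(** The limit depends only on the germ along U; it suffices to require this
    for the germ of 0. *)
Definition consistent R :=
  forall f, R f -> U [set y | f (Some y) = 0] -> f None = 0.

(** A ring homomorphism to k defined on a subring of the ultrapower of k along
    U, encoded by its graph: each member of R carries its image at None. *)
Record place R : Prop := Place {
  place_alg : function_algebra R;
  place_consistent : consistent R }.

Lemma place_eq R f g : place R -> R f -> R g ->
  U [set y | f (Some y) = g (Some y)] -> f None = g None.
Proof.
move=> [algR conR] Rf Rg Ufg; apply/eqP; rewrite -subr_eq0; apply/eqP.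
pose h o := f o + (-1) * g o.
have -> : f None - g None = h None by rewrite /h mulN1r.
apply: conR; first by apply: (fun_add algR) => //; apply: (fun_mul algR) => //;
  apply: (fun_cst algR).
by apply: filterS Ufg => y /=; rewrite /h => ->; ring.
Qed.

Lemma entrywise_place_eq R m n (M N : option T -> 'M[k]_(m, n)) :
  place R -> entrywise R M -> entrywise R N ->
  U [set y | M (Some y) = N (Some y)] -> M None = N None.
Proof.
move=> plR RM RN UMN; apply/matrixP=> i j.
apply: (place_eq plR (RM i j) (RN i j)).
by apply: filterS UMN => y /= ->.
Qed.

(** An equation satisfied by x along U whose limit is the equation 1 = 0: it
    prevents x from having a finite limit. *)
Definition obstruction R x n := exists b : nat -> option T -> k,
  [/\ forall i, R (b i), forall i, b i None = (i == 0)%:R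
    & U [set y | \sum_(i < n.+1) b i (Some y) * x y ^+ i = 0]].

(** Multiplying the equation of z by x to the n+1 gives an equation in x whose
    leading coefficient tends to 1, which eliminates the leading term of the
    equation of x. *)
Lemma obstruction_descent R x z n m : function_algebra R ->
  U [set y | x y * z y = 1] -> (m <= n.+1)%N ->
  obstruction R x n.+1 -> obstruction R z m -> obstruction R x n.
Proof.
move=> algR Uxz le_mn [b [Rb b0 Ub]] [b' [Rb' b'0 Ub']].
(* b'_0 * equation of x - b_{n+1} * x^{n+1} * equation of 1/x: the terms of
   degree n+1 cancel. *)
pose c i o := b' 0 o * b i o
   + (-1) * (b n.+1 o * (if (n.+1 - i <= m)%N then b' (n.+1 - i)%N o else 0)).
exists c; split=> [i|i|].
- apply: (fun_add algR) => //; first exact: (fun_mul algR).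
  apply: (fun_mul algR) => //; first exact: (fun_cst algR).
  by apply: (fun_mul algR) => //; case: (n.+1 - i <= m)%N => //;
    apply: (fun_cst algR).
- by rewrite /c b'0 !b0 /= mulr1n mulr0n mul1r mul0r mulr0 addr0.
apply: filterS3 Uxz Ub Ub' => y /= xz eb eb'.
have eb'' : \sum_(i < n.+2) (if (n.+1 - i <= m)%N then b' (n.+1 - i)%N (Some y) else 0)
    * x y ^+ i = 0.
  rewrite (reindex_inj rev_ord_inj) /=.
  transitivity (x y ^+ n.+1 * \sum_(i < m.+1) b' i (Some y) * z y ^+ i);
    last first.
    by rewrite eb' mulr0.
  rewrite mulr_sumr (big_ord_widen_cond n.+2 xpredT
     (fun i => x y ^+ n.+1 * (b' i (Some y) * z y ^+ i))) //.
  rewrite [RHS]big_mkcond /=; apply: eq_bigr => i _.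
  have lein : (i <= n.+1)%N by rewrite -ltnS.
  rewrite subSS (subKn lein) ltnS; case: ifP => _; last by rewrite mul0r.
  have -> : x y ^+ n.+1 = x y ^+ (n.+1 - i) * x y ^+ i by rewrite -exprD subnK.
  set u := b' _ _; set v := x y ^+ (_ - _).
  by rewrite -[LHS]mulr1 -(expr1n _ i) -xz exprMn; ring.
have : b' 0 (Some y) * (\sum_(i < n.+2) b i (Some y) * x y ^+ i) =
       b n.+1 (Some y) * (\sum_(i < n.+2)
         (if (n.+1 - i <= m)%N then b' (n.+1 - i)%N (Some y) else 0) * x y ^+ i).
  by rewrite eb eb'' !mulr0.
rewrite big_ord_recr [in RHS]big_ord_recr /= subnn leq0n !mulrDr !mulrA.
rewrite [b n.+1 _ * b' _ _]mulrC => /addIr E.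
under eq_bigr do rewrite mulrDl -mulrA -[(-1) * _ * _]mulrA.
rewrite big_split /= -!mulr_sumr E mulN1r.
by under [X in _ - X]eq_bigr do rewrite -mulrA; rewrite -mulr_sumr subrr.
Qed.

(** x and its inverse cannot both be prevented from having a limit:
    alternating the descent lowers the degrees until the consistency of R is
    contradicted. *)
Lemma no_two_obstructions R x z n m : place R ->
  U [set y | x y * z y = 1] -> obstruction R x n -> obstruction R z m -> False.
Proof.
move=> [algR conR]; have [s les] := ubnP (n + m).
elim: s => // s IHs in x z n m les *.
wlog le_mn : x z n m les / (m <= n)%N => [hw|] Uxz.
  case: (leqP m n) => [/hw|/ltnW le_nm ox oz]; first by apply; rewrite ?les.
  apply: (hw z x m n) => //; first by rewrite addnC.
  by apply: filterS Uxz => y /=; rewrite mulrC.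
case: n le_mn les => [|n] le_mn les ox oz.
  case: ox => b [Rb b0 Ub].
  have : b 0 None = 0.
    apply: conR => //; apply: filterS Ub => y /=.
    by rewrite big_ord1 expr0 mulr1.
  by rewrite b0 => /eqP; rewrite oner_eq0.
apply: (IHs x z n m) => //; exact: (obstruction_descent algR Uxz le_mn ox oz).
Qed.

(** A named constant, so that evaluation at a point carries the structure of a
    ring morphism and commutes with Horner evaluation. *)
Definition evalf (o : option T) (f : option T -> k) : k := f o.
HB.instance Definition _ o := GRing.isZmodMorphism.Build (option T -> k) k
  (evalf o) (fun f g => erefl).
HB.instance Definition _ o := GRing.isMonoidMorphism.Build (option T -> k) k
  (evalf o) (erefl, fun f g => erefl).

Definition polyover R (p : {poly (option T -> k)}) := forall i, R p`_i.

Definition adjoin R f : (option T -> k) -> Prop :=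
  fun g => exists2 p, polyover R p & g = p.[f].

Lemma evalf_horner p f o : p.[f] o = (map_poly (evalf o) p).[f o].
Proof. exact: esym (horner_map (evalf o) p f). Qed.

Section Adjoin.
Variables (R : (option T -> k) -> Prop) (algR : function_algebra R).

Lemma polyoverC g : R g -> polyover R g%:P.
Proof.
by move=> Rg i; rewrite coefC; case: eqP => // _; apply: (fun_cst algR).
Qed.

Lemma polyoverX : polyover R 'X.
Proof. by move=> i; rewrite coefX; case: eqP => _;
  [exact: (fun_cst algR 1) | exact: (fun_cst algR 0)]. Qed.

Lemma polyoverD p q : polyover R p -> polyover R q -> polyover R (p + q).
Proof. by move=> Rp Rq i; rewrite coefD; apply: (fun_add algR). Qed.

Lemma polyoverM p q : polyover R p -> polyover R q -> polyover R (p * q).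
Proof.
move=> Rp Rq i; rewrite coefM fct_sumE.
apply: (@fun_sum _ _ _ algR _ _ _ (fun (j : 'I_i.+1) o => p`_j o * q`_(i - j) o)) => j.
exact: (fun_mul algR).
Qed.

Lemma polyover_map (q : {poly k}) : polyover R (map_poly cst q).
Proof. by move=> i; rewrite coef_map_id0 //; apply: (fun_cst algR). Qed.

Lemma adjoin_algebra f : function_algebra (adjoin R f).
Proof.
split=> [c|g h [p Rp ->] [q Rq ->]|g h [p Rp ->] [q Rq ->]].
- exists (cst c)%:P; last by rewrite hornerC.
  by apply: polyoverC; apply: (fun_cst algR).
- by exists (p + q); [apply: polyoverD | rewrite hornerD].
by exists (p * q); [apply: polyoverM | rewrite hornerM].
Qed.

Lemma sub_adjoin f g : R g -> adjoin R f g.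
Proof. by exists g%:P; [apply: polyoverC | rewrite hornerC]. Qed.

Lemma mem_adjoin f : adjoin R f f.
Proof. by exists 'X; [apply: polyoverX | rewrite hornerX]. Qed.

End Adjoin.

Lemma obstruction_poly R x (p : {poly (option T -> k)}) : polyover R p ->
  map_poly (evalf None) p = 1 ->
  U [set y | p.[extend x 0] (Some y) = 0] -> obstruction R x (size p).
Proof.
move=> Rp p1 Up; exists (fun i => p`_i); split=> [i|i|] //.
  by rewrite -coef1 -p1 coef_map.
apply: filterS Up => y /= py; rewrite -[RHS]py evalf_horner.
rewrite (@horner_coef_wide _ (size p).+1) ?(leq_trans (size_poly _ _)) //.
by apply: eq_bigr => i _; rewrite coef_map.
Qed.

Lemma extend_horner (p : {poly (option T -> k)}) x c c' y :
  p.[extend x c] (Some y) = p.[extend x c'] (Some y).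
Proof. by rewrite !evalf_horner. Qed.

(** The limits of the equations satisfied by x form an ideal of the principal
    ring k[X].  Without obstruction the ideal is proper, so it has a root c in
    the algebraically closed field k, and c can be taken as the limit of x. *)
Lemma adjoin_place R x : place R -> (forall n, ~ obstruction R x n) ->
  exists c, place (adjoin R (extend x c)).
Proof.
move=> [algR conR] Nobs.
(* limits of the polynomials over R that vanish at x along U *)
pose J (q : {poly k}) := exists p, [/\ polyover R p,
  U [set y | p.[extend x 0] (Some y) = 0] & map_poly (evalf None) p = q].
have JM q' q : J q -> J (q' * q).
  case=> p [Rp Up <-]; exists (map_poly cst q' * p); split.
  - by apply: polyoverM => //; apply: polyover_map.
  - apply: filterS Up => y /=; rewrite !evalf_horner rmorphM hornerM => ->.
    by rewrite mulr0.
  rewrite rmorphM; congr (_ * _); apply/polyP => i.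
  by rewrite coef_map coef_map_id0.
have JB q' q : J q' -> J q -> J (q' - q).
  case=> p' [Rp' Up' <-] /(JM (-1)) [p [Rp Up Ep]]; exists (p' + p); split.
  - exact: polyoverD.
  - apply: filterS2 Up' Up => y /=.
    by rewrite !evalf_horner rmorphD hornerD => -> ->; rewrite addr0.
  by rewrite rmorphD /= Ep mulN1r.
have NJ1 : ~ J 1 by case=> p [Rp Up Ep];
  exact: Nobs (obstruction_poly Rp Ep Up).
suff [c Jc] : exists c, forall q, J q -> root q c.
  exists c; split; first exact: adjoin_algebra.
  move=> g [p Rp ->] Up; rewrite evalf_horner; apply/eqP/Jc; exists p;
    split=> //.
  by apply: filterS Up => y /=; rewrite (extend_horner _ _ _ 0).
have [[q [Jq q0]]|J0] := pselect (exists q, J q /\ q != 0); last first.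
  exists 0 => q Jq; have [->|q0] := eqVneq q 0; first exact: root0.
  by case: J0; exists q.
have [n [le_qn {q Jq q0}]] : exists n, (exists q, [/\ J q, q != 0 & size q = n]) /\
   forall q, J q -> q != 0 -> (n <= size q)%N.
  have ex : exists n, `[< exists q, [/\ J q, q != 0 & size q = n] >].
    by exists (size q); apply/asboolP; exists q.
  exists (ex_minn ex); case: ex_minnP => n /asboolP ? nmin;
    split=> // q' Jq' q'0.
  by apply: nmin; apply/asboolP; exists q'.
case: le_qn => q [Jq q0 <-] qmin.
have /closed_rootP [c qc] : size q != 1%N.
  apply/negP => /size_poly1P [a a0 Eq]; apply: NJ1.
  by have := JM a^-1%:P _ Jq; rewrite Eq -polyCM mulVf.
exists c => q' Jq'.
have Jr : J (q' %% q).
  have -> : q' %% q = q' - (q' %/ q) * q.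
    by rewrite {2}(divp_eq q' q) addrC addKr.
  by apply: JB => //; apply: JM.
have [r0|rN0] := eqVneq (q' %% q) 0.
  by rewrite (divp_eq q' q) r0 addr0 rootM qc orbT.
by have := qmin _ Jr rN0; rewrite leqNgt ltn_modp q0.
Qed.

(** Chevalley's extension theorem, for one function at a time. *)
Lemma place_extension R x : place R -> exists R', [/\ place R',
  forall f, R f -> R' f
  & (exists c, R' (extend x c)) \/
    U [set y | x y != 0] /\ exists c, R' (extend (fun y => (x y)^-1) c)].
Proof.
move=> plR; have algR := place_alg plR.
have adj z : (forall n, ~ obstruction R z n) -> exists c R', [/\ place R',
    forall f, R f -> R' f & R' (extend z c)].
  move=> Nobs; have [c plR'] := adjoin_place plR Nobs;
    exists c, (adjoin R (extend z c)).
  by split=> // [f|]; [exact: sub_adjoin | exact: mem_adjoin].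
have [[n ox]|Nox] := pselect (exists n, obstruction R x n); last first.
  have [|c [R' [plR' sRR' R'x]]] := adj x.
    by move=> n ox; apply: Nox; exists n.
  by exists R'; split=> //; left; exists c.
have Ux : U [set y | x y != 0].
  have [//|Ux0] := in_ultra_setVsetC [set y | x y != 0] UU.
  case: ox => b [Rb b0 Ub].
  have : b 0%N None = 0.
    apply: (place_consistent plR) => //; apply: filterS2 Ux0 Ub => y /= /negP.
    rewrite negbK => /eqP -> ; rewrite big_ord_recl expr0 mulr1 big1 ?addr0 //.
    by move=> i _; rewrite expr0n mulr0.
  by rewrite b0 => /eqP; rewrite oner_eq0.
(* x is obstructed, so its inverse is not *)
have [|c [R' [plR' sRR' R'x]]] := adj (fun y => (x y)^-1).
  move=> m; apply: (no_two_obstructions plR _ ox).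
  by apply: filterS Ux => y /= x0; rewrite mulfV.
by exists R'; split=> //; right; split=> //; exists c.
Qed.
End Places.

(** * Limits of subspaces *)

(** Writes an entry of a matrix in echelon form as a maximal minor, so that
    bounds on minors give bounds on entries. *)
Lemma det_replaced_column (k : fieldType) d n (Q : 'M[k]_(d, n))
    (h : 'I_d -> 'I_n) i j : colsub h Q = 1%:M ->
  \det (colsub (fun l => if l == i then j else h l) Q) = Q i j.
Proof.
move=> Qh; set A := colsub _ _.
have Qhl a l : Q a (h l) = (a == l)%:R.
  by move/matrixP/(_ a l): Qh; rewrite !mxE.
rewrite (expand_det_row _ i) (bigD1 i) //= [X in _ + X]big1 ?addr0.
  rewrite /A !mxE eqxx /cofactor addnn -signr_odd odd_double expr0 mul1r.
  suff -> : row' i (col' i A) = 1%:M by rewrite det1 mulr1.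
  apply/matrixP=> a b; rewrite !mxE eq_sym (negPf (neq_lift _ _)) Qhl.
  by rewrite (inj_eq lift_inj).
by move=> l li; rewrite !mxE (negPf li) Qhl eq_sym (negPf li) mul0r.
Qed.

Lemma row_free_minor (k : fieldType) d n (M : 'M[k]_(d, n)) : row_free M ->
  exists h : {ffun 'I_d -> 'I_n}, \det (colsub h M) != 0.
Proof.
move=> fM; have fMt : row_full M^T by rewrite /row_full mxrank_tr.
exists (fullrankfun fMt); have := fullrowsub_unit fMt.
rewrite unitmxE unitfE -det_tr.
by congr (\det _ != 0); apply/matrixP=> a b; rewrite !mxE.
Qed.

Section Limits.
Variables (k : closedFieldType) (T : choiceType).
Variables (U : set_system T) (UU : UltraFilter U).
Local Notation place := (@place k T U).
Implicit Types (R : (option T -> k) -> Prop).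

Lemma ultrafilter_pigeonhole (J : finType) (A : J -> set T) :
  U [set y | exists j, A j y] -> exists j, U (A j).
Proof.
move=> UA; apply: contrapT => NA.
have UN j : U (~` A j).
  by case: (in_ultra_setVsetC (A j) UU) => // UAj; case: NA; exists j.
have UNA : U [set y | forall j, ~ A j y] by apply: filter_forall.
by have [y [[j Ajy] /(_ j)]] := filter_ex (filterI UA UNA).
Qed.

(** The points with homogeneous coordinates m have a limit in projective
    space: comparing the coordinates one at a time by place_extension singles
    out one whose quotients with all the others have a limit. *)
Lemma projective_limit (J : finType) (m : J -> T -> k) R : place R ->
  U [set y | exists j, m j y != 0] ->
  exists R' i (N : J -> option T -> k), [/\ place R', forall f, R f -> R' f,
    U [set y | m i y != 0], forall j, R' (N j)
  & forall j, U [set y | N j (Some y) = m j y / m i y]].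
Proof.
move=> plR /ultrafilter_pigeonhole[i0 Ui0].
suff [R' [i [plR' sRR' Ui Ni]]] : exists R' i, [/\ place R', forall f, R f -> R' f,
    U [set y | m i y != 0]
  & {in enum J, forall j, exists2 f, R' f & U [set y | f (Some y) = m j y / m i y]}].
  have /boolp.choice[N HN] : forall j, exists f, R' f /\ U [set y | f (Some y) = m j y / m i y].
    by move=> j; have [|f] := Ni j; [rewrite mem_enum | exists f].
  by exists R', i, N; split=> // j; case: (HN j).
elim: (enum J) => [|j s [R' [i [plR' sRR' Ui Ni]]]].
  by exists R, i0; split.
have [R'' [plR'' sR'R'' Rx]] := place_extension UU (fun y => m j y / m i y) plR'.
have algR'' := place_alg plR''.
case: Rx => [[c Rx]|[Ux [c Rx]]].
  exists R'', i; split=> // [f /sRR'/sR'R''//|j'].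
  rewrite inE => /predU1P[->|/Ni[f R'f Uf]]; last by exists f => //;
    apply: sR'R''.
  by exists (extend (fun y => m j y / m i y) c) => //; apply: filterE.
exists R'', j; split=> // [f /sRR'/sR'R''//||j'].
  by apply: filterS Ux => y /=; apply: contra_neq => ->; rewrite mul0r.
rewrite inE => /predU1P[->|/Ni[f R'f Uf]].
  exists (fun=> 1); first exact: (fun_cst algR'').
  apply: filterS Ux => y /= x0; rewrite divff //.
  by apply: contra_neq x0 => ->; rewrite mul0r.
exists (fun o => f o * extend (fun y => (m j y / m i y)^-1) c o).
  by apply: (fun_mul algR'') => //; apply: sR'R''.
by apply: filterS3 Ux Ui Uf => y /= x0 mi0 ->; rewrite invf_div mulrA divfK.
Qed.

(** The projective limit is applied to the Plucker coordinates.  Normalizing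
    the dominant minor to 1 gives an echelon basis whose entries are
    themselves quotients of minors. *)
Lemma grassmannian_limit d n (M : T -> 'M[k]_(d, n)) R : place R ->
  U [set y | row_free (M y)] ->
  exists R' (N : option T -> 'M[k]_(d, n)) (h : 'I_d -> 'I_n),
    [/\ place R', forall f, R f -> R' f, entrywise R' N,
      colsub h (N None) = 1%:M
    & U [set y | colsub h (N (Some y)) = 1%:M /\ (N (Some y) :=: M y)%MS]].
Proof.
move=> plR UM.
have UM' : U [set y | exists h : {ffun 'I_d -> 'I_n}, \det (colsub h (M y)) != 0].
  by apply: filterS UM => y; apply: row_free_minor.
have [R' [h [m [plR' sRR' Uh R'm Um]]]] :=
  projective_limit (m := fun (h : {ffun _}) y => \det (colsub h (M y))) plR UM'.
(* the entries of the echelon matrix are the normalized minors in which column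
   h i is replaced by column j *)
pose N o := \matrix_(i, j) m [ffun l => if l == i then j else h l] o.
have R'N : entrywise R' N by move=> i j; under eq_fun do rewrite mxE;
  apply: R'm.
have UN : U [set y | colsub h (N (Some y)) = 1%:M /\ (N (Some y) :=: M y)%MS].
  have UA : U [set y | forall i j, m [ffun l => if l == i then j else h l] (Some y) =
      \det (colsub [ffun l => if l == i then j else h l] (M y)) / \det (colsub h (M y))].
    by apply: filter_forall => i; apply: filter_forall => j; apply: Um.
  apply: filterS2 Uh UA => y /= h0 my.
  have hU : colsub h (M y) \in unitmx by rewrite unitmxE unitfE.
  pose Q := invmx (colsub h (M y)) *m M y.
  have MQ h' : colsub h' (M y) = colsub h (M y) *m colsub h' Q.
    by rewrite mulmx_colsub /Q mulKVmx.
  have Qh : colsub h Q = 1%:M by rewrite /Q -mulmx_colsub mulVmx.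
  have EN : N (Some y) = Q.
    apply/matrixP=> i j; rewrite mxE my MQ det_mulmx mulrC mulKf //.
    rewrite -(det_replaced_column i j Qh); congr (\det _).
    by apply/matrixP=> a b; rewrite !mxE ffunE.
  by rewrite EN; split=> //; apply: eqmxMfull; rewrite row_full_unit unitmx_inv.
exists R', N, h; split=> //.
have plR'' := place_alg plR'.
apply: (entrywise_place_eq UU plR' (entrywise_colsub h R'N) (entrywise_cst plR'' 1%:M)).
by apply: filterS UN => y [].
Qed.

(** The coefficients that express L in terms of N are read off from the
    identity block of N, so the inclusion is an identity between functions
    with a limit. *)
Lemma limit_submx d n (N : option T -> 'M[k]_(d, n)) m (L : option T -> 'M[k]_(m, n))
    (h : 'I_d -> 'I_n) R : place R -> entrywise R N -> entrywise R L ->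
  U [set y | colsub h (N (Some y)) = 1%:M] ->
  U [set y | (L (Some y) <= N (Some y))%MS] -> (L None <= N None)%MS.
Proof.
move=> plR RN RL Uh ULN; have algR := place_alg plR.
apply/submxP; exists (colsub h (L None)).
apply: (entrywise_place_eq UU plR RL
  (entrywise_mul algR (entrywise_colsub h RL) RN)).
apply: filterS2 Uh ULN => y /= Nh /submxP[Q ->].
by rewrite -mulmx_colsub Nh mulmx1.
Qed.

Lemma limit_mulmx_eq0 m n p (A : option T -> 'M[k]_(m, n)) (B : option T -> 'M[k]_(n, p)) R :
  place R -> entrywise R A -> entrywise R B ->
  U [set y | A (Some y) *m B (Some y) = 0] -> A None *m B None = 0.
Proof.
move=> plR RA RB; have algR := place_alg plR.
exact: (entrywise_place_eq UU plR (entrywise_mul algR RA RB) (entrywise_cst algR 0)).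
Qed.

End Limits.

(** * Closure points as specializations *)

Section ZariskiClosure.
Variables (k : closedFieldType) (n r : nat).
Local Notation T := {ffun 'I_r -> 'End('rV[k]_n)}.
Implicit Types (Y : set T) (A : T).

Definition zariski_closure Y : set T :=
  [set A | forall p, (forall B, Y B -> mpoly.meval (entries B) p = 0) ->
     mpoly.meval (entries A) p = 0].

Lemma zariski_closure_closed Y : zariski_closure Y `<=` Y -> zariski_closed Y.
Proof.
move=> clY; exists [set p | forall B, Y B -> mpoly.meval (entries B) p = 0].
apply/seteqP; split=> [A YA p|A clA]; first exact.
by apply: clY => p Yp; apply: clA.
Qed.

(** The sets where a polynomial nonzero at A does not vanish have the finite
    intersection property in Y, since A is in the closure; any ultrafilter
    containing them works. *)
Lemma specialization Y A : zariski_closure Y A ->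
  exists2 U : set_system T, UltraFilter U & U Y /\
    exists2 R, @place k T U R & forall p,
      R (fun o => mpoly.meval (entries (if o is Some y then y else A)) p).
Proof.
move=> clA.
pose D p := [set B | Y B /\ mpoly.meval (entries B) p != 0].
pose F := filter_from [set p | mpoly.meval (entries A) p != 0] D.
have FF : ProperFilter F.
  apply: filter_from_proper; last first.
    move=> p /= /eqP pA; apply: contrapT => Dp; apply: pA; apply: clA => B YB.
    by apply/eqP; apply: contrapT => /negP pB; apply: Dp; exists B.
  apply: filter_from_filter; first by exists (mpoly.mpolyC _ 1);
    rewrite /= mpoly.mevalC oner_neq0.
  move=> p q /= pA qA; exists (p * q); first by rewrite mpoly.mevalM mulf_neq0.
  by move=> B [YB]; rewrite mpoly.mevalM mulf_eq0 negb_or => /andP[].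
have [U [UU sFU]] := ultraFilterLemma FF.
exists U => //; split.
  by apply: sFU; exists (mpoly.mpolyC _ 1) => [|B []//];
    rewrite /= mpoly.mevalC oner_neq0.
exists (fun f => exists p, f =
  fun o => mpoly.meval (entries (if o is Some y then y else A)) p); last first.
  by move=> p; exists p.
split; first split=> [c|f g [p ->] [q ->]|f g [p ->] [q ->]].
- by exists (mpoly.mpolyC _ c); apply/funext=> o; rewrite mpoly.mevalC.
- by exists (p + q); apply/funext=> o; rewrite mpoly.mevalD.
- by exists (p * q); apply/funext=> o; rewrite mpoly.mevalM.
move=> f [p ->] U0; apply: contrapT => /eqP pA.
have UDp : U (D p) by apply: sFU; exists p.
by have [B [[_ /eqP]]] := filter_ex (filterI UDp U0).
Qed.

End ZariskiClosure.

(** * Irreducibility from polynomial curves *)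

Section PolynomialFunctions.
Variable k : fieldType.

(** A function k -> k rather than an element of {poly k}, so that curves of
    matrices are functions and their algebra is that of function_algebra. *)
Definition polyfun (f : k -> k) := exists q : {poly k}, forall s, f s = q.[s].

Lemma polyfun_algebra : function_algebra polyfun.
Proof.
split=> [c|f g [p Ep] [q Eq]|f g [p Ep] [q Eq]].
- by exists c%:P => s; rewrite hornerC.
- by exists (p + q) => s; rewrite hornerD Ep Eq.
by exists (p * q) => s; rewrite hornerM Ep Eq.
Qed.

Lemma polyfun_id : polyfun id.
Proof. by exists 'X => s; rewrite hornerX. Qed.

Lemma polyfun_affine (a c : k) : polyfun (fun s => a + s * c).
Proof. by exists (a%:P + 'X * c%:P) => s; rewrite !hornerE. Qed.

Lemma affine_nonzero (a c : k) : c != 0 -> exists s, a + s * c != 0.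
Proof.
move=> c0; have [->|a0] := eqVneq a 0; first by exists 1; rewrite add0r mul1r.
by exists 0; rewrite mul0r addr0.
Qed.

Lemma fun_meval (X : Type) (R : (X -> k) -> Prop) N (v : X -> 'I_N -> k) p :
  function_algebra R -> (forall c, R (fun x => v x c)) ->
  R (fun x => mpoly.meval (v x) p).
Proof.
move=> algR Rv; under eq_fun do rewrite mpoly.mevalE.
apply: (@fun_sum _ _ _ algR _ _ _
  (fun m x => mpoly.mcoeff m p * \prod_i v x i ^+ mpoly.fun_of_multinom m i)) => m.
apply: (fun_mul algR); first exact: (fun_cst algR).
apply: (@fun_prod _ _ _ algR _ _ _ (fun i x => v x i ^+ mpoly.fun_of_multinom m i)) => i.
elim: (mpoly.fun_of_multinom m i) => [|e IHe]; first exact: (fun_cst algR).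
by under eq_fun do rewrite exprS; apply: (fun_mul algR).
Qed.

End PolynomialFunctions.

Definition endmx (k : fieldType) n (X : 'M[k]_n) : 'End('rV[k]_n) :=
  linfun (mulmxr X).

Lemma endmxK (k : fieldType) n (X : 'M[k]_n) : lin1_mx (endmx X) = X.
Proof. by apply/row_matrixP=> i; rewrite !rowE mul_rV_lin1 /= lfunE. Qed.

Lemma lin1_mxK (k : fieldType) n (A : 'End('rV[k]_n)) : endmx (lin1_mx A) = A.
Proof. by apply/lfunP=> v; rewrite /endmx lfunE /= mul_rV_lin1. Qed.

Lemma polyfun_nonzero2 (k : closedFieldType) (f g : k -> k) (s t : k) :
  polyfun f -> polyfun g -> f s != 0 -> g t != 0 ->
  exists x, f x != 0 /\ g x != 0.
Proof.
move=> [p Ep] [q Eq]; rewrite Ep Eq => ps qt.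
have p0 : p != 0 by apply: contra_neq ps => ->; rewrite horner0.
have q0 : q != 0 by apply: contra_neq qt => ->; rewrite horner0.
have /closed_nonrootP[u] := mulf_neq0 p0 q0.
by rewrite rootM negb_or => /andP[pu qu]; exists u; rewrite Ep Eq.
Qed.

Section Curves.
Variables (k : closedFieldType) (n r : nat).
Local Notation T := {ffun 'I_r -> 'End('rV[k]_n)}.

(** Describes endomorphism tuples by the matrices in which the Zariski
    topology is expressed. *)
Definition of_matrices (B : 'I_r -> 'M[k]_n) : T := [ffun i => endmx (B i)].

Lemma entries_polyfun (B : k -> 'I_r -> 'M[k]_n) p :
  (forall i, entrywise (@polyfun k) (fun s => B s i)) ->
  polyfun (fun s => mpoly.meval (entries (of_matrices (B s))) p).
Proof.
move=> Bpoly; apply: fun_meval => [|c]; first exact: polyfun_algebra.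
rewrite /entries; case: (enum_val c) => [[i a] b].
under eq_fun do rewrite ffunE /endmx lfunE /= -rowE mxE.
exact: Bpoly.
Qed.

(** If two closed sets cover Y, neither of them being all of Y, take a point
    outside each, and a polynomial equation of each that fails there.  Both
    equations fail at almost all points of the curve that joins the two
    points. *)
Lemma irreducible_of_curves (Y : set T) : Y !=set0 ->
  (forall y1 y2, Y y1 -> Y y2 -> exists (B : k -> 'I_r -> 'M[k]_n) (q : {poly k}),
     [/\ forall i, entrywise (@polyfun k) (fun s => B s i),
         of_matrices (B 0) = y1, of_matrices (B 1) = y2, q != 0
       & forall s, q.[s] != 0 -> Y (of_matrices (B s))]) ->
  irreducible Y.
Proof.
move=> Y0 Ycurve; split=> // C1 C2 [D1 [S1 ->] ->] [D2 [S2 ->] ->] EY.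
apply: contrapT => /not_orP[NY1 NY2].
have out (S : set _) : Y <> Y `&` [set A | forall p, S p -> mpoly.meval (entries A) p = 0] ->
    exists y p, [/\ Y y, S p & mpoly.meval (entries y) p != 0].
  move=> NY; apply: contrapT => Nex; apply: NY; apply/seteqP;
    split=> [y Yy|y []//].
  split=> // p Sp; apply: contrapT => /eqP py; apply: Nex.
  by exists y, p.
have [y1 [p1 [Yy1 Sp1 p1y1]]] := out _ NY1.
have [y2 [p2 [Yy2 Sp2 p2y2]]] := out _ NY2.
have [B [q [Bpoly B0 B1 q0 Yq]]] := Ycurve _ _ Yy1 Yy2.
have [q1 Eq1] := entries_polyfun p1 Bpoly.
have [q2 Eq2] := entries_polyfun p2 Bpoly.
have q10 : q1 != 0.
  by apply: contra_neq p1y1 => q10; rewrite -B0 Eq1 q10 horner0.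
have q20 : q2 != 0.
  by apply: contra_neq p2y2 => q20; rewrite -B1 Eq2 q20 horner0.
have /closed_nonrootP[s] : q * q1 * q2 != 0 by rewrite !mulf_neq0.
rewrite /root !hornerM !mulf_eq0 !negb_or => /andP[/andP[qs q1s] q2s].
have := Yq s qs; rewrite EY => -[[_ /(_ _ Sp1)]|[_ /(_ _ Sp2)]].
  by rewrite Eq1 => /eqP; rewrite (negPf q1s).
by rewrite Eq2 => /eqP; rewrite (negPf q2s).
Qed.

End Curves.

(** * Invariant subspaces as row spaces *)

Section RowSpace.
Variables (k : fieldType) (n : nat).

Definition rowspace m (M : 'M[k]_(m, n)) : {vspace 'rV[k]_n} :=
  limg (linfun (mulmxr M)).

Lemma mem_rowspace m (M : 'M[k]_(m, n)) v : (v \in rowspace M) = (v <= M)%MS.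
Proof.
apply/memv_imgP/submxP => [[u _ ->]|[u ->]]; first by exists u; rewrite lfunE.
by exists u; rewrite ?memvf ?lfunE.
Qed.

Lemma rowspace_sub m p (M : 'M[k]_(m, n)) (N : 'M[k]_(p, n)) :
  (rowspace M <= rowspace N)%VS = (M <= N)%MS.
Proof.
apply/subvP/idP => [sMN|sMN v]; last by rewrite !mem_rowspace => /submx_trans->.
by apply/row_subP=> i; rewrite -mem_rowspace sMN // mem_rowspace row_sub.
Qed.

Lemma dim_rowspace m (M : 'M[k]_(m, n)) : \dim (rowspace M) = \rank M.
Proof.
have -> : rowspace M = rowspace (row_base M).
  by apply/eqP; rewrite eqEsubv !rowspace_sub !eq_row_base !submx_refl.
rewrite limg_dim_eq ?dimvf //=; first by rewrite /dim /= mul1n.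
apply/eqP; rewrite -subv0; apply/subvP => u.
rewrite memv_cap memvf /= memv_ker lfunE /= memv0 => /eqP uM.
apply/eqP; apply: (row_free_inj (row_base_free M)).
by rewrite uM mul0mx.
Qed.

Lemma vspace_rowspace (W : {vspace 'rV[k]_n}) :
  exists2 M : 'M[k]_(\dim W, n), row_free M & W = rowspace M.
Proof.
pose M := \matrix_(i < \dim W) (vbasis W)`_i.
have EW : W = rowspace M.
  apply/vspaceP => v; rewrite mem_rowspace;
    apply/idP/submxP => [/coord_vbasis->|[u ->]].
    exists (\row_i coord (vbasis W) i v); rewrite mulmx_sum_row.
    by apply: eq_bigr => i _; rewrite rowK mxE.
  rewrite mulmx_sum_row memv_suml // => i _; rewrite rowK memvZ //.
  by rewrite vbasis_mem // mem_nth // size_tuple.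
by exists M => //; rewrite /row_free -dim_rowspace -EW.
Qed.

End RowSpace.

Section MatrixForm.
Variables (k : fieldType) (n : nat) (eps : bool).
Variable form : {hermitian 'rV[k]_n for eps & idfun}.
Local Notation G := (matrix_of_form form).

(** The matrix of rho, by lin1_rho. *)
Definition adjmx (X : 'M[k]_n) : 'M[k]_n := G *m X^T *m invmx G.

Lemma lin1_rho A : lin1_mx (rho form A) = adjmx (lin1_mx A).
Proof. by rewrite endmxK. Qed.

Lemma gram_tr : G^T = (-1) ^+ eps *: G.
Proof.
apply/matrixP=> i j; rewrite !mxE.
by rewrite hermC.
Qed.

(** W meets its orthogonal in the radical of the restricted form, whose Gram
    matrix in the basis M is the matrix M G M^T. *)
Lemma isotropy_rank_rowspace m (M : 'M[k]_(m, n)) : row_free M ->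
  isotropy_rank form (rowspace M) = (m - \rank (M *m G *m M^T))%N.
Proof.
move=> fM; rewrite /isotropy_rank.
have -> : (rowspace M :&: orthov form (rowspace M))%VS =
    rowspace (kermx (M *m G *m M^T) *m M).
  apply/vspaceP => v; rewrite memv_cap !mem_rowspace.
  apply/andP/submxP => [[/submxP[u ->] /mem_orthovP uW]|[u ->]].
    have /sub_kermxP/submxP[w ->] : u *m (M *m G *m M^T) = 0.
      apply/matrixP=> a j; rewrite ord1.
      have := uW (row j M); rewrite mem_rowspace row_sub => /(_ isT).
      by rewrite formE tr_row colE !mulmxA -colE mxE => ->; rewrite mxE.
    by exists w; rewrite mulmxA.
  rewrite mulmxA submxMl; split=> //; apply/mem_orthovP => w.
  rewrite mem_rowspace => /submxP[w' ->].
  rewrite formE trmx_mul; set K := kermx _.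
  have -> : u *m K *m M *m G *m (M^T *m w'^T) = u *m (K *m (M *m G *m M^T)) *m w'^T.
    by rewrite !mulmxA.
  by rewrite mulmx_ker mulmx0 mul0mx mxE.
by rewrite dim_rowspace mxrankMfree // mxrank_ker.
Qed.

Definition rho_stable r (A : 'I_r -> 'M[k]_n) m (M : 'M[k]_(m, n)) :=
  forall i, (M *m A i <= M)%MS /\ (M *m adjmx (A i) <= M)%MS.

Lemma rho_invariant_rowspace r (A : {ffun 'I_r -> 'End('rV[k]_n)}) m (M : 'M[k]_(m, n)) :
  rho_invariant form A (rowspace M) <-> rho_stable (fun i => lin1_mx (A i)) M.
Proof.
have lfunP (B : 'End('rV[k]_n)) :
    (B @: rowspace M <= rowspace M)%VS = (M *m lin1_mx B <= M)%MS.
  apply/subvP/idP => [sBM|sBM v].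
    apply/row_subP=> i; rewrite row_mul mul_rV_lin1 -mem_rowspace sBM //.
    by rewrite memv_img // mem_rowspace row_sub.
  case/memv_imgP=> w; rewrite !mem_rowspace => wM ->.
  by rewrite -mul_rV_lin1; apply: submx_trans (submxMr _ wM) sBM.
by split=> inv i; have [h1 h2] := inv i; move: h1 h2; rewrite !lfunP lin1_rho.
Qed.

Lemma ZgeP l d r A : (l <= d)%N -> Zge form l d r A <->
  exists M : 'M[k]_(d, n), [/\ row_free M,
    rho_stable (fun i => lin1_mx (A i)) M & (\rank (M *m G *m M^T) + l <= d)%N].
Proof.
move=> le_ld; split=> [[W [invW dimW rkW]]|[M [fM stM rkM]]].
  case: d / dimW le_ld rkW => le_ld rkW.
  have [M fM EW] := vspace_rowspace W; exists M.
  move: invW rkW; rewrite {1 2}EW => /rho_invariant_rowspace stM.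
  rewrite isotropy_rank_rowspace // => rkM; split=> //.
  by have := rank_leq_row (M *m G *m M^T); lia.
exists (rowspace M); split; first exact/rho_invariant_rowspace.
  by rewrite dim_rowspace (eqP fM).
by rewrite isotropy_rank_rowspace //; lia.
Qed.

Lemma Zge_gtd l d r A : (d < l)%N -> ~ Zge form l d r A.
Proof.
move=> lt_dl [W [_ dimW]]; rewrite leqNgt => /negP; apply.
by rewrite (leq_ltn_trans _ lt_dl) // -dimW dimvS // capvSl.
Qed.

End MatrixForm.

(** * Closedness of the rank conditions *)

Lemma row_free_colsub (k : fieldType) d n (N : 'M[k]_(d, n)) (h : 'I_d -> 'I_n) :
  colsub h N = 1%:M -> row_free N.
Proof.
move=> Nh; apply/row_freeP.
exists (colsub h 1%:M); by rewrite mulmx_colsub mulmx1.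
Qed.

Lemma row_free_sub_exists (k : fieldType) m n (K : 'M[k]_(m, n)) l :
  (l <= \rank K)%N -> exists2 Q : 'M[k]_(l, n), row_free Q & (Q <= K)%MS.
Proof.
move=> le_lK; exists ((pid_mx l : 'M_(l, \rank K)) *m row_base K).
  by rewrite /row_free mxrankMfree ?row_base_free // rank_pid_mx.
by rewrite (submx_trans (submxMl _ _)) ?eq_row_base.
Qed.

Section StratumClosed.
Variables (k : closedFieldType) (n r : nat) (eps : bool).
Variable form : {hermitian 'rV[k]_n for eps & idfun}.
Local Notation G := (matrix_of_form form).
Local Notation T := {ffun 'I_r -> 'End('rV[k]_n)}.
Implicit Types (Y : set T) (A : T).

Local Notation mats A := (fun i => lin1_mx (A i)).
Local Notation spec A := (fun o => if o is Some y then y else A).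

Lemma entrywise_specialization (R : (option T -> k) -> Prop) A i :
  (forall p, R (fun o => mpoly.meval (entries (spec A o)) p)) ->
  entrywise R (fun o => lin1_mx (spec A o i)).
Proof.
move=> Rp a b; have := Rp (mpoly.mpolyX _ (mpoly.mnm1 (enum_rank (i, a, b)))).
congr (R _); apply: funext => o.
by rewrite mpoly.mevalXU /entries enum_rankK mxE.
Qed.

(** Invariance is an inclusion between limits of subspaces, hence passes to
    the limit. *)
Lemma rho_stable_limit Y A d (M : T -> 'M[k]_(d, n)) : zariski_closure Y A ->
  (forall y, Y y -> row_free (M y) /\ rho_stable form (mats y) (M y)) ->
  exists2 U : set_system T, UltraFilter U & U Y /\
  exists R (N : option T -> 'M[k]_(d, n)) (h : 'I_d -> 'I_n),
   [/\ @place k T U R, entrywise R N, row_free (N None),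
       rho_stable form (mats A) (N None)
     & U [set y | colsub h (N (Some y)) = 1%:M /\ (N (Some y) :=: M y)%MS]].
Proof.
move=> clA YM; have [U UU [UY [R0 plR0 R0p]]] := specialization clA.
exists U => //; split=> //.
have UM : U [set y | row_free (M y)] by apply: filterS UY => y /YM[].
have [R [N [h [plR sR0R RN Nh UN]]]] := grassmannian_limit UU plR0 UM.
exists R, N, h; split=> //; first exact: row_free_colsub Nh.
have algR := place_alg plR.
have RA i : entrywise R (fun o => lin1_mx (spec A o i)).
  by apply: entrywise_specialization => p; apply: sR0R.
have UNh : U [set y | colsub h (N (Some y)) = 1%:M] by apply: filterS UN => y [].
move=> i; split.
  apply: (limit_submx (L := fun o => N o *m lin1_mx (spec A o i)) UU plR RN _ UNh).
    exact: entrywise_mul.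
  apply: filterS2 UY UN => y /YM[_ /(_ i)[sM _]] [_ EN] /=.
  by rewrite EN (submx_trans _ sM) // submxMr // EN.
apply: (limit_submx (L := fun o => N o *m adjmx form (lin1_mx (spec A o i)))
          UU plR RN _ UNh).
  apply: entrywise_mul => //; apply: entrywise_mul => //;
    last exact: entrywise_cst.
  by apply: entrywise_mul => //; [exact: entrywise_cst | exact: entrywise_tr].
apply: filterS2 UY UN => y /YM[_ /(_ i)[_ sM]] [_ EN] /=.
by rewrite EN (submx_trans _ sM) // submxMr // EN.
Qed.

(** Isotropy rank at least l is witnessed by an l-dimensional subspace of W
    orthogonal to W; taking the limit of this witness along with that of W
    avoids any computation with minors. *)
Lemma Zge_closed l d : (l <= d)%N -> zariski_closed (Zge form l d r).
Proof.
move=> le_ld; apply: zariski_closure_closed => A clA; apply/ZgeP => //.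
have /boolp.choice[M HM] (y : T) : exists M : 'M[k]_(d, n), Zge form l d r y ->
   [/\ row_free M, rho_stable form (mats y) M & (\rank (M *m G *m M^T) + l <= d)%N].
  have [/ZgeP Zy|NZy] := pselect (Zge form l d r y); last by exists 0.
  by have [M HM] := Zy le_ld; exists M.
have /boolp.choice[L HL] (y : T) : exists L : 'M[k]_(l, n), Zge form l d r y ->
   [/\ row_free L, (L <= M y)%MS & L *m (G *m (M y)^T) = 0].
  have [/HM[fM stM rkM]|NZy] := pselect (Zge form l d r y); last by exists 0.
  have [|Q fQ /sub_kermxP Q0] := @row_free_sub_exists _ _ _ (kermx (M y *m G *m (M y)^T)) l.
    by rewrite mxrank_ker; lia.
  exists (Q *m M y) => _; split; last by rewrite -[RHS]Q0 !mulmxA.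
    by rewrite /row_free mxrankMfree.
  exact: submxMl.
have [y /HM[]//|U UU [UZ [R [N [h [plR RN fN stN UN]]]]]] :=
  rho_stable_limit (M := M) clA.
have UL : U [set y | row_free (L y)] by apply: filterS UZ => y /HL[].
have [R' [L' [h' [plR' sRR' R'L' L'h' UL']]]] := grassmannian_limit UU plR UL.
have R'N : entrywise R' N by move=> i j; apply: sRR'.
have algR' := place_alg plR'.
have L'N : (L' None <= N None)%MS.
  apply: (limit_submx (h := h) UU plR' R'N R'L');
    first by apply: filterS UN => y [].
  by apply: filterS3 UZ UN UL' => y /HL[_ sLM _] [_ EN] [_ EL] /=;
    rewrite EL EN.
have L'G : L' None *m (G *m (N None)^T) = 0.
  apply: (limit_mulmx_eq0 (B := fun o => G *m (N o)^T) UU plR' R'L').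
    by apply: entrywise_mul => //; [exact: entrywise_cst | exact: entrywise_tr].
  apply: filterS3 UZ UN UL' => y /HL[_ _ L0] [_ EN] [_ EL] /=.
  have /submxP[P ->] : (L' (Some y) <= L y)%MS by rewrite EL.
  have /submxP[P' ->] : (N (Some y) <= M y)%MS by rewrite EN.
  rewrite trmx_mul -mulmxA (mulmxA G) (mulmxA (L y)) L0 mul0mx mulmx0 //.
exists (N None); split=> //.
have fL' := row_free_colsub L'h'.
move: L'N L'G fL' => /submxP[Q ->] Q0.
have QK : (Q <= kermx (N None *m G *m (N None)^T))%MS.
  by apply/sub_kermxP; rewrite -[RHS]Q0 !mulmxA.
rewrite /row_free mxrankMfree // => /eqP rkQ.
by have := mxrankS QK; rewrite rkQ mxrank_ker leq_subRL ?rank_leq_row.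
Qed.

End StratumClosed.

(** * Bilinear forms and quasi-reflections *)

Definition bil (k : fieldType) n (G : 'M[k]_n) (u v : 'rV[k]_n) : k :=
  (u *m G *m v^T) 0 0.

Definition isometry (k : fieldType) n (G g : 'M[k]_n) := g *m G *m g^T = G.

Section Bilinear.
Variables (k : fieldType) (n : nat) (G : 'M[k]_n).
Implicit Types u v w : 'rV[k]_n.

Lemma bilDl u v w : bil G (u + v) w = bil G u w + bil G v w.
Proof. by rewrite /bil !mulmxDl mxE. Qed.

Lemma bilZl a u v : bil G (a *: u) v = a * bil G u v.
Proof. by rewrite /bil -!scalemxAl mxE. Qed.

Lemma bilDr u v w : bil G u (v + w) = bil G u v + bil G u w.
Proof. by rewrite /bil linearD mulmxDr mxE. Qed.

Lemma bilZr a u v : bil G u (a *: v) = a * bil G u v.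
Proof. by rewrite /bil linearZ -scalemxAr mxE. Qed.

Lemma bilBl u v w : bil G (u - v) w = bil G u w - bil G v w.
Proof. by rewrite bilDl -scaleN1r bilZl mulN1r. Qed.

Lemma bilBr u v w : bil G u (v - w) = bil G u v - bil G u w.
Proof. by rewrite bilDr -scaleN1r bilZr mulN1r. Qed.

Lemma bilE u v : u *m G *m v^T = (bil G u v)%:M.
Proof. exact: mx11_scalar. Qed.

Lemma bil_rows p q (A : 'M_(p, n)) (B : 'M_(q, n)) i j :
  bil G (row i A) (row j B) = (A *m G *m B^T) i j.
Proof.
rewrite /bil tr_row colE mulmxA -!row_mul -colE [LHS]mxE.
by rewrite [LHS]mxE.
Qed.

Variable eps : bool.
Hypothesis G_tr : G^T = (-1) ^+ eps *: G.

Lemma bilC u v : bil G v u = (-1) ^+ eps * bil G u v.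
Proof.
rewrite /bil.
have -> : (v *m G *m u^T) 0 0 = ((v *m G *m u^T)^T) 0 0 by rewrite [RHS]mxE.
by rewrite !trmx_mul trmxK G_tr -scalemxAl -scalemxAr mulmxA [LHS]mxE.
Qed.

(** Orthogonality is symmetric for both kinds of form. *)
Lemma gram_eq0C m p (A : 'M_(m, n)) (B : 'M_(p, n)) :
  A *m G *m B^T = 0 -> B *m G *m A^T = 0.
Proof.
move=> AB0; apply: trmx_inj; rewrite !trmx_mul trmxK G_tr -scalemxAl -scalemxAr.
by rewrite mulmxA AB0 scaler0 trmx0.
Qed.

Hypothesis two_neq0 : 2%:R != 0 :> k.

Lemma skew_bil0 v : eps -> bil G v v = 0.
Proof.
move=> eps1; have := bilC v v; rewrite eps1 expr1 mulN1r => /eqP.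
by rewrite -addr_eq0 -mulr2n -mulr_natl mulf_eq0 (negPf two_neq0) => /eqP.
Qed.

(** Polarization. *)
Lemma nonisotropic_combination u v : eps = false -> bil G u v != 0 ->
  exists a c, bil G (a *: u + c *: v) (a *: u + c *: v) != 0.
Proof.
move=> eps0 uv.
have [qu|] := eqVneq (bil G u u) 0; last by exists 1, 0;
  rewrite scale1r scale0r addr0.
have [qv|] := eqVneq (bil G v v) 0; last by exists 0, 1;
  rewrite scale1r scale0r add0r.
exists 1, 1; rewrite !scale1r !(bilDl, bilDr) qu qv (bilC u v) eps0 expr0 mul1r.
by rewrite add0r addr0 -mulr2n -mulr_natl mulf_neq0.
Qed.

End Bilinear.

(** Two block triangular factorizations of the matrix with rows (1, u) and
    (-v, 1). *)
Lemma det_rank_one_update (k : fieldType) n (u : 'cV[k]_n) (v : 'rV[k]_n) :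
  \det (1%:M + u *m v) = 1 + (v *m u) 0 0.
Proof.
pose B := block_mx 1%:M u (- v) 1%:M : 'M[k]_(n + 1).
have E1 : B = block_mx 1%:M 0 (- v) 1%:M *m block_mx 1%:M u 0 (1%:M + v *m u).
  rewrite mulmx_block !mul1mx !mulmx1 !mul0mx ?mulmx0 !addr0.
  by rewrite mulNmx addrC addrK.
have E2 : B = block_mx (1%:M + u *m v) u 0 1%:M *m block_mx 1%:M 0 (- v) 1%:M.
  rewrite mulmx_block !mul1mx !mulmx1 !mul0mx ?mulmx0 !add0r.
  by rewrite mulmxN addrK.
have := congr1 determinant E2; rewrite {1}E1 !det_mulmx !det_ublock !det_lblock.
by rewrite !det1 !mul1r !mulr1 => <-; rewrite det_mx11 !mxE eqxx.
Qed.

Section QuasiReflections.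
Variables (k : fieldType) (two_neq0 : 2%:R != 0 :> k).
Variables (n : nat) (eps : bool) (G : 'M[k]_n).
Hypotheses (G_unit : G \in unitmx) (G_tr : G^T = (-1) ^+ eps *: G).
Implicit Types (u v w z e f : 'rV[k]_n) (c : k).
Local Notation b := (bil G).
Local Notation isometry := (isometry G).

(** For a symmetric form the admissible c is -2 / b z z and this is the
    reflection in z; for a skew form every c is admissible and this is a
    transvection.  Treating both at once makes a single proof of Witt's
    theorem serve both forms. *)
Definition quasi_reflection z c : 'M[k]_n := 1%:M + c *: (G *m z^T *m z).

Definition admissible z c := 1 + (-1) ^+ eps + c * b z z = 0.

Lemma mul_quasi_reflection v z c : v *m quasi_reflection z c = v + (c * b v z) *: z.
Proof.
rewrite mulmxDr mulmx1 -scalemxAr !mulmxA bilE mul_scalar_mx scalerA.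
by [].
Qed.

Lemma det_quasi_reflection z c :
  \det (quasi_reflection z c) = 1 + c * b z z.
Proof.
rewrite /quasi_reflection scalemxAr det_rank_one_update -scalemxAl mxE.
by rewrite mulmxA.
Qed.

Lemma det_admissible z c : admissible z c ->
  \det (quasi_reflection z c) = - (-1) ^+ eps.
Proof.
move=> zc; rewrite det_quasi_reflection; apply/eqP; rewrite -addr_eq0.
by rewrite addrAC; apply/eqP.
Qed.

Lemma isometryP g : (forall u v, b (u *m g) (v *m g) = b u v) -> isometry g.
Proof.
move=> gP; apply/matrixP=> i j.
have E (H : 'M[k]_n) : bil H (delta_mx 0 i) (delta_mx 0 j) = H i j.
  by rewrite /bil trmx_delta -rowE -colE !mxE.
by rewrite -[LHS]E -[RHS]E -gP /bil trmx_mul !mulmxA.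
Qed.

Lemma isometry_bil g u v : isometry g -> b (u *m g) (v *m g) = b u v.
Proof.
by move=> gG; rewrite /bil trmx_mul !mulmxA -[u *m g *m G]mulmxA -(mulmxA u) gG.
Qed.

Lemma isometry1 : isometry 1%:M.
Proof. by rewrite /isometry mul1mx trmx1 mulmx1. Qed.

Lemma isometryM g h : isometry g -> isometry h -> isometry (g *m h).
Proof.
move=> gG hG; rewrite /isometry trmx_mul !mulmxA -(mulmxA g) -(mulmxA g).
by rewrite hG gG.
Qed.

Lemma isometry_unit g : isometry g -> g \in unitmx.
Proof.
move=> gG; have := G_unit; rewrite -{1}gG unitmx_mul => /andP[].
by rewrite unitmx_mul => /andP[].
Qed.

Lemma quasi_reflection_isometry z c : admissible z c ->
  isometry (quasi_reflection z c).
Proof.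
move=> zc; apply: isometryP => u v; rewrite !mul_quasi_reflection.
rewrite !(bilDl, bilDr, bilZl, bilZr) (bilC G_tr v z).
transitivity (b u v + c * b u z * b v z * (1 + (-1) ^+ eps + c * b z z)).
  by ring.
by rewrite zc mulr0 addr0.
Qed.

(** The double orthogonal of F is F. *)
Lemma gram_perp_separates m (F : 'M_(m, n)) e : ~~ (e <= F)%MS ->
  exists2 z, z *m G *m F^T = 0 & b e z != 0.
Proof.
rewrite submxE => /rV0Pn[j ej]; pose c := col j (cokermx F).
have Fc : F *m c = 0 by rewrite /c colE mulmxA mulmx_coker mul0mx.
have Gz : G *m (c^T *m (invmx G)^T)^T = c by rewrite trmx_mul !trmxK mulKVmx.
exists (c^T *m (invmx G)^T); first by apply: (gram_eq0C G_tr);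
  rewrite -mulmxA Gz.
by rewrite /bil -mulmxA Gz /c colE mulmxA -colE mxE.
Qed.

(** If all vectors orthogonal to F were isotropic, then by polarization f
    would be orthogonal to all of them, and so would lie in F. *)
Lemma nonisotropic_perp m (F : 'M_(m, n)) f : eps = false ->
  ~~ (f <= F)%MS -> f *m G *m F^T = 0 ->
  exists2 z, z *m G *m F^T = 0 & b z z != 0.
Proof.
move=> eps0 fF f0; have [z z0 fz] := gram_perp_separates fF.
have [a [c qac]] := nonisotropic_combination G_tr two_neq0 eps0 fz.
exists (a *: f + c *: z) => //.
by rewrite !mulmxDl -!scalemxAl f0 z0 !scaler0 addr0.
Qed.

(** The length is recorded because for a symmetric form its parity gives the
    determinant, and because it decides which power of the base isometry the
    word is joined to. *)
Inductive quasi_reflection_word : nat -> 'M[k]_n -> Prop :=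
| empty_word : quasi_reflection_word 0 1%:M
| snoc_word m g z c : quasi_reflection_word m g -> admissible z c ->
    quasi_reflection_word m.+1 (g *m quasi_reflection z c).

Lemma word_isometry m g : quasi_reflection_word m g -> isometry g.
Proof.
elim=> [|{}m {}g z c _ gG zc]; first exact: isometry1.
by apply: isometryM => //; apply: quasi_reflection_isometry.
Qed.

Lemma cat_word m g m' g' : quasi_reflection_word m g ->
  quasi_reflection_word m' g' -> quasi_reflection_word (m + m') (g *m g').
Proof.
move=> wg; elim=> [|{}m' {}g' z c _ IH zc]; first by rewrite addn0 mulmx1.
by rewrite addnS mulmxA; apply: snoc_word.
Qed.

Lemma quasi_reflection_word1 z c : admissible z c ->
  quasi_reflection_word 1 (quasi_reflection z c).
Proof. by move=> zc; rewrite -[X in _ _ X]mul1mx; apply: snoc_word;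
  first exact: empty_word. Qed.

Lemma quasi_reflection_fix m (F : 'M_(m, n)) z c : z *m G *m F^T = 0 ->
  F *m quasi_reflection z c = F.
Proof.
move=> /(gram_eq0C G_tr) F0.
by rewrite mulmxDr mulmx1 -scalemxAr !mulmxA F0 mul0mx scaler0 addr0.
Qed.

(** The quasi-reflection in e - f with the right scalar carries e to f,
    provided that e - f is not orthogonal to e, and fixes F because e - f is
    orthogonal to F. *)
Lemma witt_one m (F : 'M_(m, n)) e f : b e e = b f f ->
  e *m G *m F^T = f *m G *m F^T -> b e (e - f) != 0 ->
  exists2 g, quasi_reflection_word 1 g & F *m g = F /\ e *m g = f.
Proof.
move=> ef eF d0; set c := - (b e (e - f))^-1.
exists (quasi_reflection (e - f) c).
  apply: quasi_reflection_word1.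
  have E : b (e - f) (e - f) = (1 + (-1) ^+ eps) * b e (e - f).
    rewrite !(bilBl, bilBr) (bilC G_tr e f) ef.
    transitivity ((1 + (-1) ^+ eps) * (b f f - b e f) + (b f f - (-1) ^+ eps * b f f)).
      by ring.
    by rewrite -(bilC G_tr) subrr addr0.
  by rewrite /admissible E /c; field.
split; first by apply: quasi_reflection_fix; rewrite !mulmxBl eF subrr.
rewrite mul_quasi_reflection /c mulNr mulVf // scaleN1r opprB.
by rewrite addrC subrK.
Qed.

End QuasiReflections.

Section WittStep.
Variables (k : closedFieldType) (two_neq0 : 2%:R != 0 :> k).
Variables (n : nat) (eps : bool) (G : 'M[k]_n).
Hypotheses (G_unit : G \in unitmx) (G_tr : G^T = (-1) ^+ eps *: G).
Implicit Types (z e f : 'rV[k]_n) (c : k).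
Local Notation b := (bil G).
Local Notation admissible := (admissible eps G).
Local Notation quasi_reflection := (quasi_reflection G).
Local Notation quasi_reflection_word := (quasi_reflection_word eps G).

(** Each of the three requirements fails on a proper closed subset of the
    orthogonal of F; lines through suitable points meet all three complements
    at once. *)
Lemma common_perp m (F : 'M_(m, n)) e f :
  ~~ (e <= F)%MS -> ~~ (f <= F)%MS ->
  (eps = false -> exists2 z, z *m G *m F^T = 0 & b z z != 0) ->
  exists z c, [/\ z *m G *m F^T = 0, b e z != 0, b f z != 0, c != 0 & admissible z c].
Proof.
move=> eF fF hz.
have [z1 z10 ez1] := gram_perp_separates G_unit G_tr eF.
have [z2 z20 fz2] := gram_perp_separates G_unit G_tr fF.
have [z [z0 ez fz]] : exists z, [/\ z *m G *m F^T = 0, b e z != 0 & b f z != 0].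
  have [t ft] := affine_nonzero (b f z1) fz2.
  have e0 : b e z1 + 0 * b e z2 != 0 by rewrite mul0r addr0.
  have [s [es fs]] := polyfun_nonzero2 (polyfun_affine _ _) (polyfun_affine _ _) e0 ft.
  exists (z1 + s *: z2); rewrite !mulmxDl -!scalemxAl z10 z20 scaler0 addr0.
  by rewrite !bilDr !bilZr.
have [eps1|eps0] : eps \/ eps = false by case: (eps); [left|right].
  exists z, 1; split=> //; first exact: oner_neq0.
  by rewrite /admissible (skew_bil0 G_tr two_neq0 _ eps1) eps1 expr1 mulr0 addr0 subrr.
have [z3 z30 q3] := hz eps0.
have [t et] := affine_nonzero (b e z3) ez.
have [u fu] := affine_nonzero (b f z3) fz.
have [s1 [es1 fs1]] := polyfun_nonzero2 (polyfun_affine _ _) (polyfun_affine _ _) et fu.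
pose g s := (b e z3 + s * b e z) * (b f z3 + s * b f z).
pose q s := b z3 z3 + s * (b z3 z + b z z3) + s * (s * b z z).
have polyg : polyfun g by apply: (fun_mul (polyfun_algebra k));
  apply: polyfun_affine.
have polyq : polyfun q.
  apply: (fun_add (polyfun_algebra k)); first exact: polyfun_affine.
  by exists ('X * ('X * (b z z)%:P)) => s; rewrite !hornerE.
have gs1 : g s1 != 0 by rewrite mulf_neq0.
have q0 : q 0 != 0 by rewrite /q !mul0r !addr0.
have [s [gs qs]] := polyfun_nonzero2 polyg polyq gs1 q0.
have Eq : b (z3 + s *: z) (z3 + s *: z) = q s.
  by rewrite !(bilDl, bilDr, bilZl, bilZr) /q; ring.
move: gs; rewrite /g mulf_eq0 negb_or => /andP[es fs].
exists (z3 + s *: z), (- 2%:R / q s); split.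
- by rewrite !mulmxDl -!scalemxAl z0 z30 scaler0 addr0.
- by rewrite bilDr bilZr.
- by rewrite bilDr bilZr.
- by rewrite mulf_neq0 ?invr_eq0 // oppr_eq0.
by rewrite /admissible Eq eps0 expr0 divfK // subrr.
Qed.

(** When e - f is orthogonal to e, moving e first by a quasi-reflection that
    fixes F removes the obstruction to witt_one. *)
Lemma witt_step m (F : 'M_(m, n)) e f : b e e = b f f ->
  e *m G *m F^T = f *m G *m F^T -> ~~ (e <= F)%MS -> ~~ (f <= F)%MS ->
  (eps = false -> exists2 z, z *m G *m F^T = 0 & b z z != 0) ->
  exists m', exists2 g, quasi_reflection_word m' g & F *m g = F /\ e *m g = f.
Proof.
move=> ef eF NeF NfF hz.
have [d0|d0] := eqVneq (b e (e - f)) 0; last by exists 1%N;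
  apply: (witt_one G_tr).
have [z [c [z0 ez fz c0 zc]]] := common_perp NeF NfF hz.
pose s := quasi_reflection z c; have ws := quasi_reflection_word1 zc.
have sG := word_isometry G_tr ws.
have sF : F *m s = F := quasi_reflection_fix G_tr _ z0.
have [g wg [Fg eg]] : exists2 g, quasi_reflection_word 1 g & F *m g = F /\ (e *m s) *m g = f.
  apply: (witt_one G_tr); first by rewrite isometry_bil.
    rewrite mul_quasi_reflection !mulmxDl -!scalemxAl z0 scaler0 addr0 //.
  rewrite bilBr isometry_bil // mul_quasi_reflection bilDl bilZl.
  rewrite opprD addrA -bilBr d0 add0r oppr_eq0 !mulf_neq0 //.
  by rewrite (bilC G_tr f z) mulf_neq0 // signr_eq0.
exists 2%N, (s *m g); first exact: (cat_word ws wg).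
by rewrite !mulmxA sF Fg.
Qed.

End WittStep.

(** * Witt's theorem *)

Section Witt.
Variables (k : closedFieldType) (two_neq0 : 2%:R != 0 :> k).
Variables (n : nat) (eps : bool) (G : 'M[k]_n).
Hypotheses (G_unit : G \in unitmx) (G_tr : G^T = (-1) ^+ eps *: G).
Local Notation word := (quasi_reflection_word eps G).

(** The rows of pid_mx m *m M are the first m rows of M, followed by zero
    rows: a way to truncate a frame without changing its size. *)
Lemma row_notin_pid d (M : 'M[k]_(d, n)) m (j : 'I_d) : row_free M -> (m <= j)%N ->
  ~~ (row j M <= (pid_mx m : 'M_d) *m M)%MS.
Proof.
move=> fM le_mj; apply/submxP => -[u];
  rewrite rowE mulmxA => /(row_free_inj fM).
move/matrixP/(_ 0 j); rewrite !mxE !eqxx big1 => [/eqP|a _].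
  by rewrite oner_eq0.
rewrite mxE; case: eqP => [->|]; rewrite ?mulr0 //.
by rewrite ltnNge le_mj mulr0.
Qed.

(** Isometric frames are matched one vector at a time.  For a symmetric form
    the Gram matrix has to be diagonal: then the next vector is orthogonal to
    the previous ones without lying in their span, which provides the
    anisotropic vector that witt_step asks for. *)
Lemma witt_frames d (M N : 'M[k]_(d, n)) : row_free M -> row_free N ->
  M *m G *m M^T = N *m G *m N^T ->
  (eps = false -> is_diag_mx (N *m G *m N^T)) ->
  exists m, exists2 g, word m g & M *m g = N.
Proof.
move=> fM fN EMN diagN.
suff [m [g wg Mg]] : exists m, exists2 g, word m g &
    forall j : 'I_d, (j < d)%N -> row j (M *m g) = row j N.
  by exists m, g => //; apply/row_matrixP => j; apply: Mg.
have [s le_sd] : exists s, s = d by exists d.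
rewrite -{3}le_sd; have {le_sd} : (s <= d)%N by rewrite le_sd.
elim: s => [|s IHs] lt_sd; first by exists 0%N, 1%:M; [exact: empty_word|].
have [m [g wg Mg]] := IHs (ltnW lt_sd).
have gG := word_isometry G_tr wg.
pose j := Ordinal lt_sd; pose P : 'M[k]_d := pid_mx s.
have EP : P *m (M *m g) = P *m N.
  apply/row_matrixP=> i; rewrite !row_mul.
  have [lt_is|le_si] := ltnP i s.
    have -> : row i P = delta_mx 0 i.
      by apply/rowP=> a; rewrite !mxE lt_is andbT eqxx /= eq_sym.
    by rewrite -!rowE Mg.
  have -> : row i P = 0.
    by apply/rowP=> a; rewrite !mxE [(i < s)%N]ltnNge le_si andbF.
  by rewrite !mul0mx.
have EMg : (M *m g) *m G *m (M *m g)^T = N *m G *m N^T.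
  by rewrite -EMN trmx_mul !mulmxA -(mulmxA M) -(mulmxA M) gG.
have fMg : row_free (M *m g).
  by rewrite /row_free mxrankMfree // row_free_unit (isometry_unit G_unit gG).
have rowG (A B : 'M[k]_(d, n)) : row j A *m G *m B^T = row j (A *m G *m B^T).
  by rewrite !row_mul.
have rowGP (A B : 'M[k]_(d, n)) :
    row j A *m G *m (P *m B)^T = row j (A *m G *m B^T) *m P^T.
  by rewrite trmx_mul mulmxA rowG.
have [|||||m' [g' wg' [Fg' eg']]] := witt_step (m := d) two_neq0 G_unit G_tr
    (F := P *m N) (e := row j (M *m g)) (f := row j N).
- have H (A : 'M[k]_(d, n)) : bil G (row j A) (row j A) = (A *m G *m A^T) j j.
    by rewrite /bil tr_row colE mulmxA rowG -colE !mxE.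
  by rewrite !H EMg.
- by rewrite -{1}EP !rowGP EMg.
- by rewrite -EP row_notin_pid.
- by rewrite row_notin_pid.
- move=> eps0; apply: (nonisotropic_perp two_neq0 G_unit G_tr (f := row j N)) => //.
    by rewrite row_notin_pid.
  rewrite rowGP; apply/rowP => a; rewrite [LHS]mxE [RHS]mxE big1 // => i _.
  have [E|ne] := eqVneq (j : nat) i.
    rewrite [P^T i a]mxE [P a i]mxE; have [->|] := eqVneq (a : nat) i;
      last by rewrite mulr0.
    by rewrite -E /= ltnn mulr0.
  by rewrite [X in X * _]mxE (is_diag_mxP (diagN eps0)) ?mul0r.
exists (m + m')%N, (g *m g'); first exact: cat_word.
move=> i; rewrite ltnS leq_eqVlt => /orP[/eqP is_|lt_is].
  have -> : i = j by apply: val_inj.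
  by rewrite mulmxA row_mul.
rewrite mulmxA row_mul Mg //.
have -> : row i N = row i (P *m N).
  rewrite row_mul; have -> : row i P = delta_mx 0 i.
    by apply/rowP=> a; rewrite !mxE lt_is andbT eqxx /= eq_sym.
  by rewrite -rowE.
by rewrite -row_mul Fg'.
Qed.

End Witt.

Lemma closed_field_square (k : closedFieldType) (c : k) : exists s, s ^+ 2 = c.
Proof.
have [|s /rootP] := closed_rootP ('X^2 - c%:P : {poly k}) _.
  by rewrite size_XnsubC.
by rewrite !hornerE => /eqP; rewrite subr_eq0 => /eqP; exists s.
Qed.

Section Congruence.
Variables (k : closedFieldType) (two_neq0 : 2%:R != 0 :> k) (eps : bool).

(** p projects along the rows of E onto their orthogonal.  If the form
    vanished on the image of p, its rank would be at most the number of rows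
    of E. *)
Lemma residual_pairing d m (S : 'M[k]_d) (E : 'M[k]_(m, d)) :
  S^T = (-1) ^+ eps *: S -> E *m S *m E^T \in unitmx -> (m < \rank S)%N ->
  exists x y, [/\ x *m S *m E^T = 0, y *m S *m E^T = 0 & bil S x y != 0].
Proof.
move=> Str Kunit lt_m; set K := E *m S *m E^T.
(* the orthogonal projection along the row space of E *)
pose p := 1%:M - S *m E^T *m invmx K *m E.
have pE : p *m S *m E^T = 0.
  rewrite !mulmxBl !mul1mx; apply/eqP; rewrite subr_eq0; apply/eqP.
  by rewrite -!mulmxA (mulmxA E) -/K mulVmx // mulmx1.
have pSp : p *m S *m p^T = p *m S.
  have -> : p^T = 1%:M - E^T *m (S *m E^T *m invmx K)^T.
    by rewrite linearB /= trmx1 trmx_mul.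
  by rewrite mulmxBr mulmx1 mulmxA pE mul0mx subr0.
have pS0 : p *m S != 0.
  apply: contraTneq lt_m => /eqP; rewrite mulmxBl mul1mx subr_eq0 => /eqP ES.
  rewrite -leqNgt ES; apply: leq_trans (mxrankM_maxl _ _) _.
  exact: leq_trans (mxrankM_maxr _ _) (rank_leq_row _).
have [i [j pij]] : exists i j, (p *m S *m p^T) i j != 0.
  by apply/matrix0Pn; rewrite pSp.
exists (row i p), (row j p); rewrite -!row_mul pE !row0; split=> //.
by rewrite bil_rows.
Qed.

(** The smallest nondegenerate blocks: a unit vector for a symmetric form, a
    hyperbolic pair for a skew one. *)
Definition model_dim := if eps then 2%N else 1%N.

Definition model_gram : 'M[k]_model_dim :=
  \matrix_(i, j) if eps then (i < j)%:R - (j < i)%:R else 1.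

Lemma model_gram_unit : model_gram \in unitmx.
Proof.
rewrite /model_gram /model_dim; case: eps.
  rewrite unitmxE (expand_det_row _ 0) !big_ord_recl big_ord0 !mxE /= /cofactor.
  by rewrite !det_mx11 !mxE /=; rewrite subrr mul0r add0r addr0 subr0 mul1r expr1 sub0r mulrNN mulr1 unitr1.
by rewrite unitmxE det_mx11 mxE unitr1.
Qed.

Lemma model_exists d m (S : 'M[k]_d) (E : 'M[k]_(m, d)) :
  S^T = (-1) ^+ eps *: S -> E *m S *m E^T \in unitmx -> (m < \rank S)%N ->
  exists2 P : 'M[k]_(model_dim, d), P *m S *m E^T = 0 & P *m S *m P^T = model_gram.
Proof.
move=> Str Kunit lt_m; have [x [y [x0 y0 xy]]] := residual_pairing Str Kunit lt_m.
rewrite /model_gram /model_dim; case: eps Str => Str.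
  have q0 v : bil S v v = 0 by apply: (skew_bil0 Str two_neq0).
  pose P := col_mx ((bil S x y)^-1 *: x) y : 'M_(1 + 1, d).
  have P0 : P *m S *m E^T = 0.
    by rewrite /P !mul_col_mx -!scalemxAl x0 y0 scaler0 col_mx0.
  have PP : P *m S *m P^T = block_mx 0 1%:M (-1)%:M 0.
    rewrite /P tr_col_mx mul_col_mx mul_col_row !bilE !(bilZl, bilZr) !q0 (bilC Str x y).
    rewrite expr1 !mulr0 mulVf // mulN1r mulrN mulVf //.
    by rewrite raddf0.
  exists P; first exact: P0.
  apply: etrans PP _; apply/matrixP=> i j.
  case: (@split_ordP 1 1 i) => i' ->; case: (@split_ordP 1 1 j) => j' ->;
    by rewrite ?(block_mxEul, block_mxEur, block_mxEdl,
      block_mxEdr) !mxE !ord1 /= ?subr0 ?sub0r ?subrr.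
have [z z0 qz] : exists2 z, z *m S *m E^T = 0 & bil S z z != 0.
  have [a [c qac]] := nonisotropic_combination Str two_neq0 erefl xy.
  exists (a *: x + c *: y) => //.
  by rewrite !mulmxDl -!scalemxAl x0 y0 !scaler0 addr0.
have [s s2] := closed_field_square (bil S z z)^-1.
exists (s *: z); first by rewrite -!scalemxAl z0 scaler0.
rewrite bilE bilZl bilZr mulrA -expr2 s2 mulVf //.
by apply/matrixP=> i j; rewrite !mxE !ord1.
Qed.

(** Extending two forms by the same block keeps the two Gram matrices equal,
    so no normal form has to be written down. *)
Lemma frame_extension d m (S S' : 'M[k]_d) (E E' : 'M[k]_(m, d)) :
  S^T = (-1) ^+ eps *: S -> S'^T = (-1) ^+ eps *: S' ->
  E *m S *m E^T \in unitmx -> E' *m S' *m E'^T = E *m S *m E^T ->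
  (eps = false -> is_diag_mx (E *m S *m E^T)) ->
  (m < \rank S)%N -> (m < \rank S')%N ->
  exists F F' : 'M[k]_(m + model_dim, d),
    [/\ F *m S *m F^T \in unitmx, F' *m S' *m F'^T = F *m S *m F^T
      & eps = false -> is_diag_mx (F *m S *m F^T)].
Proof.
move=> Str Str' Kunit EK diagK lt_m lt_m'.
have [P P0 PP] := model_exists Str Kunit lt_m.
have [|P' P'0 P'P'] := model_exists (E := E') Str' _ lt_m'; first by rewrite EK.
have blockE (S1 : 'M[k]_d) (E1 : 'M_(m, d)) (P1 : 'M_(model_dim, d)) :
    S1^T = (-1) ^+ eps *: S1 -> P1 *m S1 *m E1^T = 0 ->
    P1 *m S1 *m P1^T = model_gram ->
    col_mx E1 P1 *m S1 *m (col_mx E1 P1)^T = block_mx (E1 *m S1 *m E1^T) 0 0 model_gram.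
  move=> S1tr P10 P1P1; rewrite tr_col_mx mul_col_mx mul_col_row P10 P1P1.
  by rewrite (gram_eq0C S1tr P10).
exists (col_mx E P), (col_mx E' P'); rewrite !blockE // EK; split=> //.
  rewrite unitmxE det_ublock unitrM -!unitmxE Kunit.
  exact: model_gram_unit.
move=> eps0; apply/is_diag_mxP => i j ij.
rewrite /block_mx; case: (split_ordP i) ij => i' ->;
  case: (split_ordP j) => j' -> ij.
- by rewrite block_mxEul (is_diag_mxP (diagK eps0)).
- by rewrite block_mxEur mxE.
- by rewrite block_mxEdl mxE.
rewrite block_mxEdr; case/eqP: ij => /=.
have D : model_dim = 1%N by rewrite /model_dim eps0.
have small (a : 'I_model_dim) : a = 0%N :> nat.
  by have := ltn_ord a; rewrite [X in (_ < X)%N]D ltnS leqn0 => /eqP.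
by rewrite !small.
Qed.

(** Two forms of the same kind and the same rank have a common nondegenerate
    part. *)
Lemma same_rank_frames d (S S' : 'M[k]_d) :
  S^T = (-1) ^+ eps *: S -> S'^T = (-1) ^+ eps *: S' -> \rank S = \rank S' ->
  exists E E' : 'M[k]_(\rank S, d),
    [/\ E *m S *m E^T \in unitmx, E' *m S' *m E'^T = E *m S *m E^T
      & eps = false -> is_diag_mx (E *m S *m E^T)].
Proof.
move=> Str Str' rkS.
pose good m := exists E E' : 'M[k]_(m, d), [/\ E *m S *m E^T \in unitmx,
  E' *m S' *m E'^T = E *m S *m E^T & eps = false -> is_diag_mx (E *m S *m E^T)].
have good_le m : good m -> (m <= \rank S)%N.
  case=> E [E' [K _ _]]; rewrite -(mxrank_unit K).
  by rewrite (leq_trans (mxrankM_maxl _ _)) // mxrankM_maxr.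
suff H s m : good m -> (\rank S - m <= s)%N -> good (\rank S).
  apply: (H d 0%N); last by rewrite subn0 rank_leq_row.
  by exists 0, 0; split=> [||_];
    [rewrite unitmxE det_mx00 unitr1|rewrite !mul0mx|rewrite !mul0mx mx0_is_diag].
elim: s m => [|s IHs] m gm.
  rewrite leqn0 subn_eq0 => le_m; have := good_le _ gm => ge_m.
  by rewrite (_ : \rank S = m) //; apply/eqP; rewrite eqn_leq le_m.
have [lt_m le_s|le_m _] := ltnP m (\rank S); last first.
  by have := good_le _ gm => ge_m; rewrite (_ : \rank S = m) //; apply/eqP;
    rewrite eqn_leq le_m.
case: gm => E [E' [K EK dK]].
have lt_m' : (m < \rank S')%N by rewrite -rkS.
have [F [F' HF]] := frame_extension Str Str' K EK dK lt_m lt_m'.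
apply: (IHs (m + model_dim)%N); first by exists F, F'.
have : (0 < model_dim)%N by rewrite /model_dim; case: eps.
move: le_s lt_m; move: (\rank S) model_dim; lia.
Qed.

End Congruence.

Section WittTransitivity.
Variables (k : closedFieldType) (two_neq0 : 2%:R != 0 :> k).
Variables (n : nat) (eps : bool) (G : 'M[k]_n).
Hypotheses (G_unit : G \in unitmx) (G_tr : G^T = (-1) ^+ eps *: G).

(** A maximal nondegenerate frame together with a frame of the radical. *)
Lemma radical_frame d m (S : 'M[k]_d) (E : 'M[k]_(m, d)) (R : 'M[k]_(d - m, d)) :
  S^T = (-1) ^+ eps *: S -> E *m S *m E^T \in unitmx -> row_free R -> R *m S = 0 ->
  row_free (col_mx E R) /\
  col_mx E R *m S *m (col_mx E R)^T = block_mx (E *m S *m E^T) 0 0 0.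
Proof.
move=> Str Kunit fR R0.
have RE : R *m S *m E^T = 0 by rewrite R0 mul0mx.
split; last first.
  by rewrite tr_col_mx mul_col_mx mul_col_row R0 !mul0mx (gram_eq0C Str RE).
rewrite -kermx_eq0; apply/eqP/row_matrixP => i; rewrite row0.
set u := row i _; have : u *m col_mx E R = 0 by rewrite -row_mul mulmx_ker row0.
rewrite -[u]hsubmxK mul_row_col; set a := lsubmx u; set c := rsubmx u => ac.
have a0 : a = 0.
  have : (a *m E + c *m R) *m S *m E^T = 0 by rewrite ac !mul0mx.
  rewrite !mulmxDl -[c *m R *m S]mulmxA R0 mulmx0 mul0mx addr0.
  by rewrite -!mulmxA (mulmxA E) => /(congr1 (mulmx^~ (invmx (E *m S *m E^T))));
    rewrite mulmxK // mul0mx.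
move: ac; rewrite a0 mul0mx add0r => /eqP; rewrite mulmx_free_eq0 // => /eqP->.
by rewrite row_mx0.
Qed.

(** Witt's theorem for subspaces: with frames adapted to their radicals,
    subspaces of equal dimension and equal rank have bases with the same Gram
    matrix. *)
Lemma witt_subspaces d (M N : 'M[k]_(d, n)) : row_free M -> row_free N ->
  \rank (M *m G *m M^T) = \rank (N *m G *m N^T) ->
  exists m, exists2 g, quasi_reflection_word eps G m g & (M *m g :=: N)%MS.
Proof.
move=> fM fN rkMN.
have gram_tr (A : 'M[k]_(d, n)) : (A *m G *m A^T)^T = (-1) ^+ eps *: (A *m G *m A^T).
  by rewrite !trmx_mul trmxK G_tr -scalemxAl -scalemxAr mulmxA.
have [E [E' [K EK dK]]] := same_rank_frames two_neq0 (gram_tr M) (gram_tr N) rkMN.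
move: rkMN E E' K EK dK; set q := \rank (M *m G *m M^T) => rkMN E E' K EK dK.
have rad (A : 'M[k]_(d, n)) : \rank (A *m G *m A^T) = q ->
    exists2 R : 'M[k]_(d - q, d), row_free R & R *m (A *m G *m A^T) = 0.
  move=> rkA; have [|R fR /sub_kermxP R0] :=
    @row_free_sub_exists _ _ _ (kermx (A *m G *m A^T)) (d - q).
    by rewrite mxrank_ker rkA.
  by exists R.
have [R fR R0] := rad M erefl; have [R' fR' R'0] := rad N (esym rkMN).
have [fER gER] := radical_frame (gram_tr M) K fR R0.
have [|fER' gER'] := radical_frame (E := E') (gram_tr N) _ fR' R'0;
  first by rewrite EK.
have le_qd : (q <= d)%N by rewrite /q rank_leq_row.
have full (A : 'M[k]_(q + (d - q), d)) : row_free A -> row_full A.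
  by move=> /eqP rkA; rewrite /row_full rkA subnKC.
have gramE (A : 'M[k]_(q + (d - q), d)) (B : 'M[k]_(d, n)) :
   (A *m B) *m G *m (A *m B)^T = A *m (B *m G *m B^T) *m A^T.
  by rewrite trmx_mul !mulmxA.
have [||||m [g wg Mg]] := witt_frames two_neq0 G_unit G_tr
   (M := col_mx E R *m M) (N := col_mx E' R' *m N).
- by rewrite /row_free mxrankMfree.
- by rewrite /row_free mxrankMfree.
- by rewrite !gramE gER gER' EK.
- move=> /dK dK'; rewrite gramE gER' EK.
  apply/is_diag_mxP => i j ij.
  case: (split_ordP i) ij => i' ->; case: (split_ordP j) => j' -> ij.
  + by rewrite block_mxEul (is_diag_mxP dK').
  + by rewrite block_mxEur mxE.
  + by rewrite block_mxEdl mxE.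
  by rewrite block_mxEdr mxE.
exists m, g => //.
have EM := eqmxMfull (M *m g) (full _ fER);
  have EN := eqmxMfull N (full _ fER').
by apply: eqmx_trans (eqmx_sym EM) _; rewrite mulmxA Mg.
Qed.

End WittTransitivity.

(** * The adjoint involution and conjugation *)

Section Adjoint.
Variables (k : fieldType) (n : nat) (eps : bool).
Variable form : {hermitian 'rV[k]_n for eps & idfun}.
Hypothesis form_nondeg : nondegenerate form.
Local Notation G := (matrix_of_form form).
Local Notation adj := (adjmx form).
Implicit Types X Y g : 'M[k]_n.

Let G_unit : G \in unitmx := gram_unit form_nondeg.

Lemma adjmxD X Y : adj (X + Y) = adj X + adj Y.
Proof. by rewrite /adjmx linearD mulmxDr mulmxDl. Qed.

Lemma adjmxZ a X : adj (a *: X) = a *: adj X.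
Proof. by rewrite /adjmx linearZ -scalemxAr -scalemxAl. Qed.

Lemma adjmxM X Y : adj (X *m Y) = adj Y *m adj X.
Proof. by rewrite /adjmx trmx_mul !mulmxA mulmxKV. Qed.

Lemma adjmxK X : adj (adj X) = X.
Proof.
rewrite /adjmx !trmx_mul trmxK trmx_inv gram_tr -scalemxAr.
have -> : invmx ((-1) ^+ eps *: G) = (-1) ^+ eps *: invmx G.
  by rewrite invmxZ ?invr_sign // unitmxZ // unitfE signr_eq0.
rewrite -!scalemxAl -!scalemxAr -!scalemxAl scalerA -signr_addb addbb scale1r.
by rewrite !mulmxA mulmxV // mul1mx mulmxK.
Qed.

Lemma similitude_adj g c : g *m G *m g^T = c *: G -> g *m adj g = c%:M.
Proof.
by move=> gG; rewrite /adjmx !mulmxA gG -scalemxAl mulmxV // scalemx1.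
Qed.

Lemma isometry_adj g : isometry G g -> adj g *m g = 1%:M.
Proof.
move=> gG; apply: mulmx1C; apply: similitude_adj.
by rewrite scale1r.
Qed.

(** adj g is a multiple of the inverse of g but is polynomial in g, so
    conjugation by a polynomial family of similitudes is again polynomial. *)
Lemma rho_stable_similitude r (A : 'I_r -> 'M[k]_n) m (M : 'M_(m, n)) g c :
  g *m G *m g^T = c *: G -> rho_stable form A M ->
  rho_stable form (fun i => adj g *m A i *m g) (M *m g).
Proof.
move=> gG stM i; have [MA MA'] := stM i; have gg := similitude_adj gG.
have H X : (M *m X <= M)%MS -> (M *m g *m (adj g *m X *m g) <= M *m g)%MS.
  move=> MX; rewrite -(mulmxA (adj g)) mulmxA -(mulmxA M) gg mul_mx_scalar.
  by rewrite -scalemxAl mulmxA scalemx_sub // submxMr.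
split; first exact: H.
by rewrite 2!adjmxM adjmxK (mulmxA (adj g)); apply: H.
Qed.

Lemma rho_stable_pullback r (A : 'I_r -> 'M[k]_n) m (M : 'M_(m, n)) g :
  isometry G g -> rho_stable form A (M *m g) ->
  rho_stable form (fun i => g *m A i *m adj g) M.
Proof.
move=> gG stM i; have [MA MA'] := stM i.
have gg : g *m adj g = 1%:M by apply: similitude_adj; rewrite scale1r.
have H X : (M *m g *m X <= M *m g)%MS -> (M *m (g *m X *m adj g) <= M)%MS.
  move=> /(submxMr (adj g)); rewrite -[M *m g *m adj g]mulmxA gg mulmx1.
  by rewrite !mulmxA.
split; first exact: H.
by rewrite 2!adjmxM adjmxK (mulmxA g); apply: H.
Qed.

Lemma rho_stable_line r (A B : 'I_r -> 'M[k]_n) m (M : 'M_(m, n)) s :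
  rho_stable form A M -> rho_stable form B M ->
  rho_stable form (fun i => A i + s *: (B i - A i)) M.
Proof.
move=> stA stB i; have [MA MA'] := stA i; have [MB MB'] := stB i.
split.
  by rewrite mulmxDr addmx_sub // -scalemxAr scalemx_sub // mulmxBr addmx_sub // eqmx_opp.
rewrite adjmxD adjmxZ -[B i - A i]/(B i + - A i) adjmxD -scaleN1r adjmxZ.
rewrite mulmxDr addmx_sub // -scalemxAr scalemx_sub // mulmxDr addmx_sub //.
by rewrite -scalemxAr scalemx_sub.
Qed.

Lemma rho_stable_eqmx r (A : 'I_r -> 'M[k]_n) m p (M : 'M_(m, n)) (N : 'M_(p, n)) :
  (M :=: N)%MS -> rho_stable form A M -> rho_stable form A N.
Proof.
move=> EMN stM i; have [MA MA'] := stM i.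
have H X : (M *m X <= M)%MS -> (N *m X <= N)%MS.
  by move=> MX; rewrite -EMN; apply: submx_trans MX; apply: submxMr;
    rewrite EMN.
by split; apply: H.
Qed.

End Adjoint.

(** * Deforming isometries *)

(** Powers of square matrices of arbitrary size, including size 0, where
    matrices do not form a nontrivial ring. *)
Fixpoint mxpow (k : fieldType) n (h : 'M[k]_n) m : 'M[k]_n :=
  if m is m'.+1 then mxpow h m' *m h else 1%:M.

Section IsometryPaths.
Variables (k : closedFieldType) (two_neq0 : 2%:R != 0 :> k).
Variables (n : nat) (eps : bool) (G : 'M[k]_n).
Hypotheses (G_unit : G \in unitmx) (G_tr : G^T = (-1) ^+ eps *: G).
Local Notation word := (quasi_reflection_word eps G).
Implicit Types (g h : 'M[k]_n) (z : 'rV[k]_n).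

(** P s / D s is a rational family of isometries of constant determinant;
    clearing the denominator leaves a polynomial family of similitudes. *)
Definition similitude_path h g := exists (P : k -> 'M[k]_n) (D : k -> k),
  [/\ entrywise (@polyfun k) P, polyfun D, D 0 = 1, P 0 = h /\ P 1 = g
    & forall s, D s != 0 -> P s *m G *m (P s)^T = (D s ^+ 2) *: G /\
        \det (P s) = D s ^+ n * \det h].

Lemma path_mul h g h' g' : similitude_path h g -> similitude_path h' g' ->
  similitude_path (h *m h') (g *m g').
Proof.
move=> [P [D [PP PD D0 [P0 P1] PG]]] [P' [D' [PP' PD' D'0 [P'0 P'1] P'G]]].
exists (fun s => P s *m P' s), (fun s => D s * D' s); split.
- exact: (entrywise_mul (polyfun_algebra k)).
- exact: (fun_mul (polyfun_algebra k)).
- by rewrite D0 D'0 mulr1.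
- by rewrite P0 P'0 P1 P'1.
move=> s; rewrite mulf_eq0 negb_or => /andP[/PG[E dE] /P'G[E' dE']].
split; last by rewrite !det_mulmx dE dE' exprMn; ring.
rewrite trmx_mul !mulmxA -(mulmxA (P s)) -(mulmxA (P s)) E'.
by rewrite -scalemxAr -scalemxAl E scalerA exprMn mulrC.
Qed.

Lemma path_cst h : isometry G h -> similitude_path h h.
Proof.
move=> hG; exists (fun=> h), (fun=> 1); split=> //.
- exact: (entrywise_cst (polyfun_algebra k)).
- exact: (fun_cst (polyfun_algebra k)).
by move=> s _; rewrite !expr1n scale1r mul1r.
Qed.

(** Scale c down to 0, which leaves the identity. *)
Lemma transvection_path z c : eps -> similitude_path 1%:M (quasi_reflection G z c).
Proof.
move=> eps1; have alg := polyfun_algebra k.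
exists (fun s => quasi_reflection G z (s * c)), (fun=> 1); split=> //.
- apply: (entrywise_add alg); first exact: (entrywise_cst alg).
  apply: (entrywise_scale alg); last exact: (entrywise_cst alg).
  by apply: (fun_mul alg (polyfun_id k)); apply: (fun_cst alg).
- exact: (fun_cst alg).
- by rewrite mul1r /quasi_reflection mul0r scale0r addr0.
move=> s _; rewrite !expr1n scale1r mul1r; split; last first.
  by rewrite det_quasi_reflection det1 (skew_bil0 G_tr two_neq0) // mulr0 addr0.
apply: (quasi_reflection_isometry G_tr).
by rewrite /admissible (skew_bil0 G_tr two_neq0) // eps1 expr1 mulr0 addr0 subrr.
Qed.

Lemma normalize_reflection z c : eps = false -> admissible eps G z c ->
  exists2 z', bil G z' z' = 1 & quasi_reflection G z c = quasi_reflection G z' (- 2%:R).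
Proof.
move=> eps0; rewrite /admissible eps0 expr0 => zc.
have Ecq : c * bil G z z = - 2%:R.
  by apply/eqP; rewrite -addr_eq0 addrC -[2%:R]/(1 + 1) zc.
have q0 : bil G z z != 0.
  by apply: contraNneq two_neq0 => q0; rewrite -oppr_eq0 -Ecq q0 mulr0.
have [t t2] := closed_field_square (bil G z z)^-1.
exists (t *: z); first by rewrite bilZl bilZr mulrA -expr2 t2 mulVf.
rewrite /quasi_reflection; congr (_ + _).
have -> : (t *: z)^T = t *: z^T by rewrite linearZ.
rewrite -!scalemxAr -!scalemxAl !scalerA -expr2 t2 -Ecq.
by rewrite mulfK.
Qed.

(** After normalization both reflections are in unit vectors u and v; move
    along the line from u to v and clear the denominator b w w of the
    reflection in w. *)
Lemma reflection_path z c z0 c0 : eps = false ->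
  admissible eps G z c -> admissible eps G z0 c0 ->
  similitude_path (quasi_reflection G z0 c0) (quasi_reflection G z c).
Proof.
move=> eps0 /(normalize_reflection eps0)[v qv ->] /(normalize_reflection eps0)[u qu ->].
have alg := polyfun_algebra k.
(* the value of D at both ends is 1, since u and v are unit vectors *)
pose w s := u + s *: (v - u); pose D s := bil G (w s) (w s).
have polyw : entrywise (@polyfun k) w.
  apply: (entrywise_add alg); first exact: (entrywise_cst alg).
  by apply: (entrywise_scale alg (polyfun_id k)); apply: (entrywise_cst alg).
have polywt : entrywise (@polyfun k) (fun s => (w s)^T) by apply: entrywise_tr.
have polyD : polyfun D.
  apply: (entrywise_mul alg) => //.
  by apply: (entrywise_mul alg) => //; apply: (entrywise_cst alg).
have w0 : w 0 = u by rewrite /w scale0r addr0.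
have w1 : w 1 = v by rewrite /w scale1r addrC subrK.
exists (fun s => D s *: 1%:M + (- 2%:R) *: (G *m (w s)^T *m w s)), D;
  split=> //.
- apply: (entrywise_add alg).
    by apply: (entrywise_scale alg) => //; apply: (entrywise_cst alg).
  apply: (entrywise_scale alg); first exact: (fun_cst alg).
  apply: (entrywise_mul alg) => //.
  by apply: (entrywise_mul alg) => //; apply: (entrywise_cst alg).
- by rewrite /D w0.
- by rewrite /D w0 w1 qu qv !scale1r.
move=> s Ds.
have -> : D s *: 1%:M + - 2%:R *: (G *m (w s)^T *m w s) =
    D s *: quasi_reflection G (w s) (- 2%:R / D s).
  by rewrite /quasi_reflection scalerDr scalerA mulrC divfK.
have ws : admissible eps G (w s) (- 2%:R / D s).
  by rewrite /admissible eps0 expr0 divfK // subrr.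
split; last first.
  rewrite detZ (det_admissible ws) det_quasi_reflection qu mulr1.
  by rewrite eps0 expr0; congr (_ * _); ring.
rewrite linearZ /= -!scalemxAl -scalemxAr scalerA -expr2; congr (_ *: _).
exact: (quasi_reflection_isometry G_tr).
Qed.

(** Each letter of the word is deformed to h simultaneously. *)
Lemma word_path h m g :
  (forall z c, admissible eps G z c -> similitude_path h (quasi_reflection G z c)) ->
  word m g -> similitude_path (mxpow h m) g.
Proof.
move=> hpath; elim=> [|{}m {}g z c _ IH zc] /=; first exact/path_cst/isometry1.
exact/path_mul/hpath.
Qed.

Lemma nonisotropic_row m (A : 'M[k]_(m, n)) : eps = false -> A *m G *m A^T != 0 ->
  exists2 z, (z <= A)%MS & bil G z z != 0.
Proof.
move=> eps0 /matrix0Pn[i [j]]; rewrite -bil_rows.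
set x := row i A; set y := row j A => xy.
have [a [c qac]] := nonisotropic_combination G_tr two_neq0 eps0 xy.
by exists (a *: x + c *: y); rewrite // addmx_sub // scalemx_sub // row_sub.
Qed.

(** For a symmetric form, the reflection in a vector z of M or of its
    orthogonal stabilizes M.  If neither contains an anisotropic z, both are
    totally isotropic, so each contains the other. *)
Lemma stabilizing_base d (M : 'M[k]_(d, n)) : row_free M ->
  ~ [/\ eps = false, (2 * d)%N = n & M *m G *m M^T = 0] ->
  exists h, [/\ isometry G h, (M *m h <= M)%MS &
    forall z c, admissible eps G z c -> similitude_path h (quasi_reflection G z c)].
Proof.
move=> fM Nexc; have [eps1|eps0] : eps \/ eps = false by case: (eps);
  [left|right].
  exists 1%:M; split; [exact: isometry1 | by rewrite mulmx1 |].
  by move=> z c _; apply: transvection_path.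
suff [z [qz zM]] : exists z, bil G z z != 0 /\
    ((z <= M)%MS \/ z *m G *m M^T = 0).
  have zc : admissible eps G z (- 2%:R / bil G z z).
    by rewrite /admissible eps0 expr0 divfK // subrr.
  exists (quasi_reflection G z (- 2%:R / bil G z z)); split.
  - exact: (quasi_reflection_isometry G_tr).
  - case: zM => [zM|zM]; last by rewrite (quasi_reflection_fix G_tr _ zM).
    rewrite mulmxDr mulmx1 addmx_sub // -scalemxAr scalemx_sub // mulmxA.
    exact: submx_trans (submxMl _ _) zM.
  by move=> z' c' zc'; apply: reflection_path zc' zc.
have [M0|/(nonisotropic_row eps0)[z zM qz]] := eqVneq (M *m G *m M^T) 0;
  last first.
  by exists z; split=> //; left.
pose K := kermx (G *m M^T).
have [K0|/(nonisotropic_row eps0)[z /submxP[u ->] qz]] :=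
    eqVneq (K *m G *m K^T) 0; last first.
  exists (u *m K); split=> //; right.
  by rewrite -!(mulmxA u) -(mulmxA K) mulmx_ker mulmx0.
case: Nexc; split=> //.
have KM : (K <= M)%MS.
  apply/row_subP => i; apply: contraT => /(gram_perp_separates G_unit G_tr)[z zM].
  have /submxP[u ->] : (z <= K)%MS by apply/sub_kermxP; rewrite mulmxA.
  by rewrite /bil trmx_mul mulmxA -!row_mul K0 mul0mx row0 mxE eqxx.
have MK : (M <= K)%MS by apply/sub_kermxP; rewrite mulmxA.
have rkK : \rank K = (n - d)%N.
  rewrite mxrank_ker -mxrank_tr trmx_mul trmxK mxrankMfree ?(eqP fM) //.
  by rewrite row_free_unit unitmx_tr.
have := mxrankS KM; have := mxrankS MK; rewrite rkK (eqP fM).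
have : (d <= n)%N by rewrite -(eqP fM) rank_leq_col.
lia.
Qed.

End IsometryPaths.

(** * The non-exceptional case *)

Section Strata.
Variables (k : closedFieldType) (two_neq0 : 2%:R != 0 :> k).
Variables (n r : nat) (eps : bool).
Variable form : {hermitian 'rV[k]_n for eps & idfun}.
Hypothesis form_nondeg : nondegenerate form.
Local Notation G := (matrix_of_form form).
Local Notation T := {ffun 'I_r -> 'End('rV[k]_n)}.
Local Notation mats A := (fun i => lin1_mx (A i)).
Local Notation adj := (adjmx form).
Implicit Types (A y : T).

Let G_unit : G \in unitmx := gram_unit form_nondeg.
Let G_tr : G^T = (-1) ^+ eps *: G := gram_tr form.

Lemma of_matricesK (y : T) : of_matrices (mats y) = y.
Proof. by apply/ffunP => i; rewrite ffunE lin1_mxK. Qed.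

Lemma mats_of_matrices (B : 'I_r -> 'M[k]_n) : mats (of_matrices B) = B.
Proof. by apply/funext => i; rewrite ffunE endmxK. Qed.

(** Pull y1 and y2 back to M by h and g, join the results by a line in the
    linear space of tuples stabilizing M, and conjugate by the path. *)
Lemma path_curve d (M : 'M[k]_(d, n)) y1 y2 h g :
  isometry G h -> isometry G g -> similitude_path G h g ->
  rho_stable form (mats y1) (M *m h) -> rho_stable form (mats y2) (M *m g) ->
  exists (B : k -> 'I_r -> 'M[k]_n) (q : {poly k}),
     [/\ forall i, entrywise (@polyfun k) (fun s => B s i),
         of_matrices (B 0) = y1, of_matrices (B 1) = y2, q != 0
       & forall s, q.[s] != 0 -> exists f, [/\ isometry G f, \det f = \det h
           & rho_stable form (B s) (M *m f)]].
Proof.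
move=> hG gG [P [D [polyP [q Dq] D0 [P0 P1] PG]]] st1 st2.
have alg := polyfun_algebra k.
have st1' := rho_stable_pullback form_nondeg hG st1.
have st2' := rho_stable_pullback form_nondeg gG st2.
have conjK f X : isometry G f -> adj f *m (f *m X *m adj f) *m f = X.
  move=> fG; rewrite -(mulmxA f X) (mulmxA (adj f) f) isometry_adj // mul1mx.
  by rewrite -(mulmxA X) isometry_adj // mulmx1.
set A1 := (fun i => h *m _ *m _) in st1';
  set A2 := (fun i => g *m _ *m _) in st2'.
pose L s i := A1 i + s *: (A2 i - A1 i).
exists (fun s i => adj (P s) *m L s i *m P s), q; split.
- move=> i; apply: (entrywise_mul alg) => //; apply: (entrywise_mul alg).
    apply: (entrywise_mul alg); last exact: (entrywise_cst alg).
    apply: (entrywise_mul alg); first exact: (entrywise_cst alg).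
    exact: entrywise_tr.
  apply: (entrywise_add alg); first exact: (entrywise_cst alg).
  by apply: (entrywise_scale alg (polyfun_id k)); apply: (entrywise_cst alg).
- rewrite -[RHS]of_matricesK; congr of_matrices; apply/funext => i.
  by rewrite /L scale0r addr0 P0 conjK.
- rewrite -[RHS]of_matricesK; congr of_matrices; apply/funext => i.
  by rewrite /L scale1r addrC subrK P1 conjK.
- by apply: contra_eq_neq D0 => q0; rewrite Dq q0 horner0 eq_sym oner_neq0.
move=> s; rewrite -Dq => Ds; have [PsG detPs] := PG s Ds.
exists ((D s)^-1 *: P s); split.
- rewrite /isometry linearZ /= -!scalemxAl -scalemxAr scalerA PsG scalerA.
  by rewrite -expr2 -exprMn mulVf // expr1n scale1r.
- by rewrite detZ detPs mulrA -exprMn mulVf // expr1n mul1r.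
apply: (rho_stable_eqmx (M := M *m P s)).
  by rewrite -scalemxAr; apply/eqmx_sym/eqmx_scale; rewrite invr_eq0.
apply: (rho_stable_similitude form_nondeg PsG).
exact: rho_stable_line.
Qed.

Lemma Zeq_subspace l d A : (l <= d)%N -> Zeq form l d r A ->
  exists M : 'M[k]_(d, n), [/\ row_free M, rho_stable form (mats A) M
    & (\rank (M *m G *m M^T) + l = d)%N].
Proof.
move=> le_ld [/ZgeP ZA NZA]; have [M [fM stM rkM]] := ZA le_ld.
exists M; split=> //; apply/eqP; rewrite eqn_leq rkM /=.
rewrite leqNgt; apply/negP => lt_d; apply: NZA.
apply/ZgeP; first exact: leq_ltn_trans (leq_addl _ _) lt_d.
by exists M; split=> //; rewrite addnS.
Qed.

(** The bound covers l = d + 1, where Zge is empty and a nonzero constant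
    separates. *)
Lemma Zge_separated l d y : (l <= d.+1)%N -> ~ Zge form l d r y ->
  exists p, (forall A, Zge form l d r A -> mpoly.meval (entries A) p = 0) /\
    mpoly.meval (entries y) p != 0.
Proof.
rewrite leq_eqVlt ltnS => /orP[/eqP -> _|le_ld Ny].
  exists (mpoly.mpolyC _ 1); rewrite mpoly.mevalC oner_neq0; split=> // A.
  by move/Zge_gtd => []//.
have [S ES] := Zge_closed r form le_ld.
apply: contrapT => Np; apply: Ny; rewrite ES => p Sp.
apply: contrapT => /eqP py; apply: Np; exists p; split=> // A.
by rewrite ES; apply.
Qed.

Lemma mxpow_stable d (M : 'M[k]_(d, n)) h m : (M *m h <= M)%MS ->
  (M *m mxpow h m <= M)%MS.
Proof.
move=> Mh; elim: m => [|m IHm] /=; first by rewrite mulmx1.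
by rewrite mulmxA (submx_trans _ Mh) // submxMr.
Qed.

Lemma mxpow_isometry h m : isometry G h -> isometry G (mxpow h m).
Proof.
by move=> hG; elim: m => [|m IHm] /=; [exact: isometry1 | exact: isometryM].
Qed.

(** The curve leaves the stratum only where the denominator of the path
    vanishes, or where an equation of the larger isotropy rank that fails at
    y1 vanishes. *)
Lemma Zeq_irreducible l d : (l <= d)%N -> Zeq form l d r !=set0 ->
  ~ [/\ eps = false, (2 * d)%N = n & l = d] -> irreducible (Zeq form l d r).
Proof.
move=> le_ld Z0 Nexc; apply: irreducible_of_curves => // y1 y2 Zy1 Zy2.
have [M1 [fM1 st1 rk1]] := Zeq_subspace le_ld Zy1;
  have [M2 [fM2 st2 rk2]] := Zeq_subspace le_ld Zy2.
have [|h [hG M1h hpath]] := stabilizing_base two_neq0 G_unit G_tr fM1.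
  by case=> e dn M0; apply: Nexc; split=> //; move: rk1; rewrite M0 mxrank0.
have [|m [g wg M1g]] := witt_subspaces two_neq0 G_unit G_tr fM1 fM2;
  first by apply: (@addIn l); rewrite rk1 rk2.
have gG := word_isometry G_tr wg; have hmG := mxpow_isometry m hG.
have M1hm : (M1 :=: M1 *m mxpow h m)%MS.
  apply/eqmx_sym/eqmxP; rewrite -(geq_leqif (mxrank_leqif_eq (mxpow_stable m M1h))).
  by rewrite mxrankMfree // row_free_unit (isometry_unit G_unit).
have [B [q [polyB B0 B1 q0 Bst]]] := path_curve hmG gG (word_path hpath wg)
  (rho_stable_eqmx M1hm st1) (rho_stable_eqmx (eqmx_sym M1g) st2).
have [p [Zp py1]] := Zge_separated (l := l.+1) le_ld (proj2 Zy1).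
have [q1 Eq1] := entries_polyfun p polyB.
have q10 : q1 != 0 by apply: contra_neq py1 => E; rewrite -B0 Eq1 E horner0.
exists B, (q * q1); split=> //; first by rewrite mulf_neq0.
move=> s; rewrite hornerM mulf_eq0 negb_or => /andP[/Bst[P [PG _ stP]] q1s].
split; last by move=> /Zp; rewrite Eq1 => /eqP; rewrite (negPf q1s).
apply/ZgeP => //; exists (M1 *m P); split.
- by rewrite /row_free mxrankMfree // row_free_unit (isometry_unit G_unit PG).
- by rewrite mats_of_matrices.
by rewrite trmx_mul !mulmxA -(mulmxA M1) -(mulmxA M1) PG rk1.
Qed.

End Strata.

(** * Lagrangian subspaces *)

Section Lagrangians.
Variables (k : fieldType) (two_neq0 : 2%:R != 0 :> k).
Variables (d : nat) (G : 'M[k]_(d + d)).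
Hypotheses (G_unit : G \in unitmx) (G_sym : G^T = G).
Implicit Types (M N L : 'M[k]_(d, d + d)) (g : 'M[k]_(d + d)).

Let G_tr : G^T = (-1) ^+ false *: G.
Proof. by rewrite expr0 scale1r. Qed.

Definition lagrangian M := row_free M /\ M *m G *m M^T = 0.

Lemma gram_transpose M N : (M *m G *m N^T)^T = N *m G *m M^T.
Proof. by rewrite !trmx_mul trmxK G_sym mulmxA. Qed.

(** Start with any L' dual to M and subtract half of its Gram matrix times M.
    *)
Lemma lagrangian_complement M : lagrangian M ->
  exists2 L, L *m G *m L^T = 0 & L *m G *m M^T = 1%:M.
Proof.
move=> [fM M0]; have fMG : row_free (M *m G).
  by rewrite /row_free mxrankMfree // row_free_unit.
have /row_freeP[B MB] := fMG; pose L' := B^T.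
have L'M : L' *m G *m M^T = 1%:M.
  by rewrite -gram_transpose trmxK MB trmx1.
(* c = -1/2 cancels S in the Gram matrix S + c S + c S of L' + c S M *)
pose S := L' *m G *m L'^T; pose c : k := - 2%:R^-1.
have St : S^T = S by rewrite gram_transpose.
exists (L' + c *: (S *m M)); last first.
  by rewrite !mulmxDl -!scalemxAl -!(mulmxA S) M0 mulmx0 scaler0 addr0.
have ML' : M *m G *m L'^T = 1%:M by rewrite -gram_transpose L'M trmx1.
have -> : (L' + c *: (S *m M))^T = L'^T + c *: (M^T *m S).
  by rewrite linearD linearZ /= trmx_mul St.
have E2 : L' *m G *m (c *: (M^T *m S)) = c *: S.
  by rewrite -scalemxAr mulmxA L'M mul1mx.
have E3 : (c *: (S *m M)) *m G *m L'^T = c *: S.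
  by rewrite -!scalemxAl -!(mulmxA S) ML' mulmx1.
have E4 : (c *: (S *m M)) *m G *m (c *: (M^T *m S)) = 0.
  rewrite -scalemxAr mulmxA -2!scalemxAl -!(mulmxA S) M0 mulmx0 scaler0 mul0mx.
  by rewrite scaler0.
rewrite mulmxDl !mulmxDr !mulmxDl E2 E3 E4 addr0 -/S.
have -> : S + c *: S + c *: S = (1 + c *+ 2) *: S.
  by rewrite [RHS]scalerDl scale1r mulr2n scalerDl addrA.
by rewrite /c mulNrn -[_^-1 *+ 2]mulr_natl mulfV // subrr scale0r.
Qed.

Lemma complement_unit M L : M *m G *m M^T = 0 -> L *m G *m M^T = 1%:M ->
  row_free M -> col_mx M L \in unitmx.
Proof.
move=> M0 LM fM; rewrite -row_free_unit -kermx_eq0.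
apply/eqP/row_matrixP => i; rewrite row0.
set u := row i _; have : u *m col_mx M L = 0 by rewrite -row_mul mulmx_ker row0.
rewrite -[u]hsubmxK mul_row_col; set a := lsubmx u; set c := rsubmx u => ac.
have c0 : c = 0.
  have : (a *m M + c *m L) *m G *m M^T = 0 by rewrite ac !mul0mx.
  by rewrite !mulmxDl -!(mulmxA a) -!(mulmxA c) M0 mulmx0 add0r LM mulmx1.
move: ac; rewrite c0 mul0mx addr0 => /eqP; rewrite mulmx_free_eq0 // => /eqP->.
by rewrite row_mx0.
Qed.

Lemma complement_split M L p (v : 'M[k]_(p, d + d)) :
  col_mx M L \in unitmx -> exists a c, v = a *m M + c *m L.
Proof.
move=> CU; exists (lsubmx (v *m invmx (col_mx M L))), (rsubmx (v *m invmx (col_mx M L))).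
by rewrite -mul_row_col hsubmxK mulmxKV.
Qed.

(** A Lagrangian is its own orthogonal. *)
Lemma lagrangian_perp M p (v : 'M[k]_(p, d + d)) : lagrangian M ->
  v *m G *m M^T = 0 -> (v <= M)%MS.
Proof.
move=> lagM; have [L L0 LM] := lagrangian_complement lagM; have [fM M0] := lagM.
have [a [c ->]] := complement_split v (complement_unit M0 LM fM).
rewrite !mulmxDl -!(mulmxA a) -!(mulmxA c) M0 mulmx0 add0r LM mulmx1 => ->.
by rewrite mul0mx addr0 submxMl.
Qed.

(** In the basis (M, L) the isometry is block triangular, and its action e on
    the quotient is dual to its action a on M, so that det a * det e = 1. *)
Lemma det_lagrangian_stabilizer M g : lagrangian M -> isometry G g ->
  (M *m g <= M)%MS -> \det g = 1.
Proof.
move=> lagM gG /submxP[a Mg]; have [L L0 LM] := lagrangian_complement lagM.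
have [fM M0] := lagM; have CU := complement_unit M0 LM fM.
have [c [e Lg]] := complement_split (L *m g) CU.
have ea : e *m a^T = 1%:M.
  rewrite -LM -[in RHS]gG.
  have -> : L *m (g *m G *m g^T) *m M^T = (L *m g) *m G *m (M *m g)^T.
    by rewrite trmx_mul !mulmxA.
  rewrite Lg Mg trmx_mul mulmxA !mulmxDl -!(mulmxA c) -!(mulmxA e) M0 mul0mx mulmx0 add0r.
  by rewrite LM mul1mx.
have Cg : col_mx M L *m g = block_mx a 0 c e *m col_mx M L.
  by rewrite mul_col_mx mul_block_col Mg Lg mul0mx addr0.
have := congr1 determinant Cg; rewrite !det_mulmx det_lblock mulrC.
have dC : \det (col_mx M L) != 0 by rewrite -unitfE -unitmxE.
move/(mulIf dC) => ->; rewrite mulrC -(det_tr a) -det_mulmx ea det1.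
by [].
Qed.

(** The linear map fixing L and carrying M to N preserves the Gram matrix; its
    determinant is 1 because it stabilizes the Lagrangian L. *)
Lemma isometry_of_frames L M N : lagrangian M -> N *m G *m N^T = 0 ->
  L *m G *m L^T = 0 -> L *m G *m M^T = 1%:M -> L *m G *m N^T = 1%:M ->
  exists g, [/\ isometry G g, \det g = 1 & M *m g = N].
Proof.
move=> [fM M0] N0 L0 LM LN.
have CU := complement_unit M0 LM fM; set C := col_mx M L in CU.
pose C' := col_mx N L.
have gramC (P : 'M[k]_(d, d + d)) : P *m G *m P^T = 0 -> L *m G *m P^T = 1%:M ->
   col_mx P L *m G *m (col_mx P L)^T = block_mx 0 1%:M 1%:M 0.
  move=> P0 LP; rewrite tr_col_mx mul_col_mx mul_col_row P0 L0 LP.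
  by rewrite -(gram_transpose L P) LP trmx1.
have [g Cg] : exists g, C *m g = C' by exists (invmx C *m C'); rewrite mulKVmx.
have gG : isometry G g.
  apply: (can_inj (mulKmx CU)); apply: (can_inj (mulmxK (_ : C^T \in unitmx))).
    by rewrite unitmx_tr.
  have -> : C *m G *m C^T = C' *m G *m C'^T by rewrite (gramC M) // (gramC N).
  by rewrite -Cg trmx_mul !mulmxA.
have /eq_col_mx[Mg Lg] : col_mx (M *m g) (L *m g) = col_mx N L.
  by rewrite -mul_col_mx Cg.
exists g; split=> //; apply: (det_lagrangian_stabilizer (M := L)) => //.
  split=> //; rewrite /row_free eqn_leq rank_leq_row /=.
  have : \rank (L *m G *m M^T) = d by rewrite LM mxrank1.
  by move=> {1}<-; rewrite -mulmxA mxrankM_maxl.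
by rewrite Lg.
Qed.

End Lagrangians.

(** * A nilpotent matrix with a prescribed invariant subspace *)

Section RegularNilpotent.
Variable k : fieldType.

Definition shiftmx n : 'M[k]_n := \matrix_(i, j) (i == j.+1 :> nat)%:R.

Lemma mxpow_shift n p (i j : 'I_n) :
  mxpow (shiftmx n) p i j = (i == (j + p)%N :> nat)%:R.
Proof.
elim: p i j => [|p IHp] i j /=; first by rewrite mxE addn0.
rewrite mxE; under eq_bigr do rewrite IHp mxE.
have [lt_jn|le_nj] := ltnP j.+1 n; last first.
  rewrite big1 => [|l _].
    by rewrite addnS -addSn ltn_eqF // (leq_trans (ltn_ord i)) // (leq_trans le_nj) ?leq_addr.
  by rewrite [(l == j.+1 :> nat)]ltn_eqF ?mulr0 // (leq_trans (ltn_ord l)).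
rewrite (bigD1 (Ordinal lt_jn)) //= eqxx mulr1 addSn -addnS big1 ?addr0 // => l.
by rewrite -val_eqE /= => /negPf->; rewrite mulr0.
Qed.

Lemma mxpow_shift_half d : mxpow (shiftmx (d + d)) d = block_mx 0 0 1%:M 0.
Proof.
apply/matrixP=> i j; rewrite mxpow_shift.
case: (split_ordP i) => i' ->; case: (split_ordP j) => j' -> /=;
  rewrite ?(block_mxEul, block_mxEur, block_mxEdl, block_mxEdr) ?mxE.
- by rewrite ltn_eqF // ltn_addl.
- by rewrite ltn_eqF // ltn_addl.
- by rewrite addnC eqn_add2r.
by rewrite ltn_eqF // -addnA ltn_add2l ltn_addl.
Qed.

Lemma mxpow_conj n (C Y : 'M[k]_n) p : C \in unitmx ->
  C *m mxpow (invmx C *m Y *m C) p = mxpow Y p *m C.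
Proof.
move=> CU; elim: p => [|p IHp] /=; first by rewrite mulmx1 mul1mx.
by rewrite !mulmxA IHp mulmxK.
Qed.

Lemma mxpow_comm n (X : 'M[k]_n) p : X *m mxpow X p = mxpow X p *m X.
Proof.
by elim: p => [|p IHp] /=; rewrite ?mulmx1 ?mul1mx // mulmxA IHp.
Qed.

(** The subspaces N X^i decrease strictly until they vanish, hence vanish
    after at most p steps, p being the number of rows of N. *)
Lemma nilpotent_stable n p q (N : 'M[k]_(p, n)) (X : 'M[k]_n) :
  (N *m X <= N)%MS -> mxpow X q = 0 -> N *m mxpow X p = 0.
Proof.
move=> NX Xq; pose Ni i := N *m mxpow X i.
have NiS i : Ni i.+1 = Ni i *m X by rewrite /Ni /= mulmxA.
have Nsub i : (Ni i.+1 <= Ni i)%MS.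
  elim: i => [|i IHi]; first by rewrite NiS /Ni /= mulmx1.
  by rewrite NiS [X in (_ <= X)%MS]NiS submxMr.
have step i : (Ni i <= Ni i.+1)%MS -> Ni i = 0.
  move=> Nii; suff H j : (Ni i <= Ni i *m mxpow X j)%MS.
    by have := H q; rewrite Xq mulmx0 => /submx0null.
  elim: j => [|j IHj] /=; first by rewrite mulmx1.
  by rewrite mulmxA (submx_trans Nii) // NiS submxMr.
have drop i : (\rank (Ni i) + i <= p)%N \/ Ni i = 0.
  elim: i => [|i [IHi|IHi]]; first by left; rewrite addn0 rank_leq_row.
    have [/step N0|NN] := boolP (Ni i <= Ni i.+1)%MS.
      by right; rewrite NiS N0 mul0mx.
    left; rewrite addnS -addSn (leq_trans _ IHi) // leq_add2r.
    rewrite ltn_neqAle mxrankS // andbT; apply: contra NN => /eqP rkN.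
    by rewrite -(geq_leqif (mxrank_leqif_sup (Nsub i))) rkN.
  by right; rewrite NiS IHi mul0mx.
have [le_p|//] := drop p; apply/eqP; rewrite -mxrank_eq0 -leqn0.
by rewrite -(leq_add2r p) add0n.
Qed.

End RegularNilpotent.

Section SeparatingNilpotent.
Variables (k : fieldType) (two_neq0 : 2%:R != 0 :> k).
Variables (d : nat) (G : 'M[k]_(d + d)).
Hypotheses (G_unit : G \in unitmx) (G_sym : G^T = G).

(** In the basis (M, L) let X be one Jordan block.  Its d-th power has kernel
    M, and annihilates every invariant subspace of dimension d. *)
Lemma nilpotent_with_unique_subspace (M : 'M[k]_(d, d + d)) : lagrangian G M ->
  exists2 X : 'M[k]_(d + d), (M *m X <= M)%MS &
    forall N : 'M[k]_(d, d + d), row_free N -> (N *m X <= N)%MS -> (N :=: M)%MS.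
Proof.
move=> lagM; have [fM M0] := lagM.
have [L L0 LM] := lagrangian_complement two_neq0 G_unit G_sym lagM.
have CU := complement_unit M0 LM fM; set C := col_mx M L in CU.
pose X := invmx C *m shiftmx k (d + d) *m C.
have splitX a c : (a *m M + c *m L) *m mxpow X d = c *m M :> 'M_(d, d + d).
  rewrite -mul_row_col -/C -mulmxA mxpow_conj // mxpow_shift_half mulmxA mul_row_block.
  by rewrite !mulmx0 mulmx1 !add0r mul_row_col mul0mx addr0.
have kerX (v : 'M[k]_(d, d + d)) : v *m mxpow X d = 0 -> (v <= M)%MS.
  have [a [c ->]] := complement_split v CU; rewrite splitX => /eqP.
  by rewrite mulmx_free_eq0 // => /eqP->; rewrite mul0mx addr0 submxMl.
have MX0 : M *m mxpow X d = 0.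
  by have := splitX 1%:M 0; rewrite !mul0mx mul1mx addr0.
exists X; first by apply: kerX; rewrite -mulmxA mxpow_comm mulmxA MX0 mul0mx.
move=> N fN NX; have NM : (N <= M)%MS.
  apply/kerX/(nilpotent_stable (q := d + d) NX).
  apply: (can_inj (mulKmx CU)); rewrite mxpow_conj // mulmx0.
  apply/matrixP=> i j; rewrite [RHS]mxE mxE big1 // => l _; rewrite mxpow_shift.
  by rewrite ltn_eqF ?mul0r // (leq_trans (ltn_ord i)) // leq_addl.
by apply/eqmxP; rewrite -(geq_leqif (mxrank_leqif_eq NM)) (eqP fM) (eqP fN).
Qed.

End SeparatingNilpotent.

(** * The exceptional case *)

Section LagrangianStratum.
Variables (k : closedFieldType) (two_neq0 : 2%:R != 0 :> k).
Variables (d r : nat) (d_gt0 : (0 < d)%N) (r_gt0 : (0 < r)%N).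
Variable form : {hermitian 'rV[k]_(d + d) for false & idfun}.
Hypothesis form_nondeg : nondegenerate form.
Local Notation G := (matrix_of_form form).
Local Notation T := {ffun 'I_r -> 'End('rV[k]_(d + d))}.
Local Notation mats A := (fun i => lin1_mx (A i)).
Local Notation adj := (adjmx form).
Implicit Types (A y : T) (M N : 'M[k]_(d, d + d)).

Let G_unit : G \in unitmx := gram_unit form_nondeg.
Let G_tr : G^T = (-1) ^+ false *: G := gram_tr form.
Let G_sym : G^T = G.
Proof. by rewrite G_tr expr0 scale1r. Qed.

Variable W0 : 'M[k]_(d, d + d).
Hypothesis lagW0 : lagrangian G W0.

(** The two components of the variety of Lagrangians, labelled relative to the
    base point W0. *)
Definition family (b : bool) M := exists g,
  [/\ isometry G g, \det g = (-1) ^+ b & (W0 *m g :=: M)%MS].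

Definition family_stratum b : set T := [set A : T | exists M,
  rho_stable form (mats A) M /\ family b M].

Lemma isometry_inv g : isometry G g -> isometry G (invmx g).
Proof.
move=> gG; have gU := isometry_unit G_unit gG; rewrite /isometry -[in LHS]gG.
by rewrite !mulmxA mulVmx // mul1mx -mulmxA -trmx_mul mulVmx // trmx1 mulmx1.
Qed.

Lemma lagrangian_eqmx M N : (M :=: N)%MS -> lagrangian G M -> lagrangian G N.
Proof.
move=> EMN [fM M0]; split; first by rewrite /row_free -EMN.
have /submxP[a ->] : (N <= M)%MS by rewrite EMN.
by rewrite trmx_mul mulmxA -!(mulmxA a) M0 mul0mx mulmx0.
Qed.

Lemma lagrangian_isometry M g : isometry G g -> lagrangian G M ->
  lagrangian G (M *m g).
Proof.
move=> gG [fM M0]; split.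
  by rewrite /row_free mxrankMfree // row_free_unit (isometry_unit G_unit).
by rewrite trmx_mul !mulmxA -(mulmxA M) -(mulmxA M) gG.
Qed.

Lemma family_lagrangian b M : family b M -> lagrangian G M.
Proof.
by case=> g [gG _ EM]; apply: (lagrangian_eqmx EM); apply: lagrangian_isometry.
Qed.

(** g h^-1 stabilizes the Lagrangian W0. *)
Lemma same_orbit_det g h : isometry G g -> isometry G h ->
  (W0 *m g :=: W0 *m h)%MS -> \det g = \det h.
Proof.
move=> gG hG Egh; have hU := isometry_unit G_unit hG.
have hiG := isometry_inv hG.
have := det_lagrangian_stabilizer two_neq0 G_unit G_sym lagW0 (isometryM gG hiG).
rewrite mulmxA det_mulmx det_inv => H.
apply: divr1_eq; apply: H.
by rewrite -[X in (_ <= X)%MS](mulmxK hU W0) submxMr // Egh.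
Qed.

Lemma family_disjoint b b' M : family b M -> family b' M -> b = b'.
Proof.
move=> [g [gG dg Eg]] [h [hG dh Eh]].
have := same_orbit_det gG hG (eqmx_trans Eg (eqmx_sym Eh)); rewrite dg dh.
have N1 : (-1 : k) != 1.
  by apply: contra_neq two_neq0 => E; rewrite -[2%:R]/(1 + 1) -{1}E addNr.
by case: b b' {dg dh} => [] [] //= /eqP;
  rewrite ?expr0 ?expr1 ?(negPf N1) // eq_sym (negPf N1).
Qed.

Lemma family_move b M N g : isometry G g -> \det g = 1 ->
  (M *m g :=: N)%MS -> family b M -> family b N.
Proof.
move=> gG dg EN [h [hG dh EM]]; exists (h *m g); split.
- exact: isometryM.
- by rewrite det_mulmx dg mulr1.
by rewrite mulmxA; apply: eqmx_trans EN; apply: eqmxMr.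
Qed.

Lemma det_isometry g : isometry G g -> exists b : bool, \det g = (-1) ^+ b.
Proof.
move=> gG; have := congr1 determinant gG; rewrite !det_mulmx det_tr.
have dG : \det G != 0 by rewrite -unitfE -unitmxE.
move/eqP; rewrite mulrAC -subr_eq0 -{2}[\det G]mul1r -mulrBl mulf_eq0 (negPf dG) orbF.
rewrite -expr2 subr_sqr_1 mulf_eq0 subr_eq0 addr_eq0 => /orP[]/eqP->.
  by exists false.
by exists true.
Qed.

Lemma lagrangian_family M : lagrangian G M -> exists b, family b M.
Proof.
move=> [fM M0]; have [fW W00] := lagW0.
have [|m [g wg EM]] := witt_subspaces two_neq0 G_unit G_tr fW fM.
  by rewrite M0 W00.
have gG := word_isometry G_tr wg; have [b db] := det_isometry gG.
by exists b, g.
Qed.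

Lemma word_det m g : quasi_reflection_word false G m g -> \det g = (-1) ^+ m.
Proof.
elim=> [|{}m {}g z c _ IH zc]; first by rewrite det1 expr0.
by rewrite det_mulmx IH (det_admissible zc) expr0 exprSr.
Qed.

Lemma reflection_exists : exists z c, admissible false G z c.
Proof.
have G0 : (1%:M : 'M[k]_(d + d)) *m G *m 1%:M^T != 0.
  rewrite mul1mx trmx1 mulmx1; apply: contraTneq G_unit => ->.
  by rewrite -row_free_unit /row_free mxrank0 eq_sym -lt0n addn_gt0 d_gt0.
have [z _ qz] := nonisotropic_row two_neq0 G_tr erefl G0.
exists z, (- 2%:R / bil G z z).
by rewrite /admissible expr0 divfK // subrr.
Qed.

Lemma family_nonempty b : exists M, family b M.
Proof.
have [z [c zc]] := reflection_exists; case: b.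
  exists (W0 *m quasi_reflection G z c), (quasi_reflection G z c); split=> //.
    exact: (quasi_reflection_isometry G_tr zc).
  by rewrite (det_admissible zc) expr0 expr1.
exists (W0 *m 1%:M), 1%:M; split=> //; first exact: isometry1.
by rewrite det1.
Qed.

Lemma reflection_involutive z c : admissible false G z c ->
  quasi_reflection G z c *m quasi_reflection G z c = 1%:M.
Proof.
move=> zc; apply/row_matrixP => i; rewrite !row_mul !rowE mulmx1.
rewrite !mul_quasi_reflection -addrA -scalerDl bilDl bilZl.
set a := bil G _ z; rewrite (_ : _ + _ = c * a * (1 + (-1) ^+ false + c * bil G z z)).
  by rewrite zc mulr0 scale0r addr0.
by rewrite expr0; ring.
Qed.

Lemma mxpow_even n (h : 'M[k]_n) m : h *m h = 1%:M -> mxpow h m.*2 = 1%:M.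
Proof.
by move=> hh; elim: m => [|m IHm] //; rewrite doubleS /= IHm mul1mx.
Qed.

(** The word joining two members of a family has determinant 1, hence even
    length m, and the base isometry of word_path, a reflection r0, satisfies
    mxpow r0 m = 1. *)
Lemma family_stratum_irreducible b : irreducible (family_stratum b).
Proof.
apply: irreducible_of_curves.
  have [M FM] := family_nonempty b; exists (of_matrices (fun=> 0)), M;
    split=> //.
  by rewrite mats_of_matrices => i;
    rewrite /adjmx trmx0 !(mulmx0, mul0mx) sub0mx.
move=> y1 y2 [M1 [st1 F1]] [M2 [st2 F2]].
have [fM1 M10] := family_lagrangian F1; have [fM2 M20] := family_lagrangian F2.
have [|m [g wg EM]] := witt_subspaces two_neq0 G_unit G_tr fM1 fM2.
  by rewrite M10 M20.
have gG := word_isometry G_tr wg.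
have m_even : ~~ odd m.
  have [g1 [g1G dg1 E1]] := F1; have [g2 [g2G dg2 E2]] := F2.
  have dE : \det (g1 *m g) = \det g2.
    apply: same_orbit_det => //; first exact: isometryM.
    rewrite mulmxA; apply: eqmx_trans (eqmxMr g E1) _.
    exact: eqmx_trans EM (eqmx_sym E2).
  move: dE; rewrite det_mulmx dg1 dg2 (word_det wg) => /eqP.
  rewrite -{2}[(-1) ^+ b]mulr1 -subr_eq0 -mulrBr mulf_eq0 signr_eq0 /=.
  rewrite -signr_odd; case: (odd m) => //=; rewrite expr1 -opprD oppr_eq0.
  by rewrite -[1 + 1]/(2%:R) (negPf two_neq0).
have [z0 [c0 z0c0]] := reflection_exists.
have path1g : similitude_path G 1%:M g.
  rewrite -(mxpow_even m./2 (reflection_involutive z0c0)).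
  have -> : m./2.*2 = m by rewrite -[RHS]odd_double_half (negbTE m_even).
  by apply: word_path wg => z c zc; apply: reflection_path zc z0c0.
have [||B [q [polyB B0 B1 q0 Bst]]] := path_curve form_nondeg (isometry1 G) gG path1g
    (M := M1) (y1 := y1) (y2 := y2).
- by rewrite mulmx1.
- exact: rho_stable_eqmx (eqmx_sym EM) st2.
exists B, q; split=> // s /Bst[f [fG df stf]]; exists (M1 *m f).
rewrite mats_of_matrices; split=> //.
by apply: (family_move fG _ _ F1); rewrite ?df ?det1.
Qed.

(** Transversality to the Lagrangian L is an open condition on N, so it holds
    for some W_y near the limit, and two Lagrangians with a common complement
    are in the same family. *)
Lemma family_stratum_closed b : zariski_closed (family_stratum b).
Proof.
apply: zariski_closure_closed => A clA.
have /boolp.choice[M HM] (y : T) : exists M, family_stratum b y ->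
    rho_stable form (mats y) M /\ family b M.
  have [[M HM]|NY] := pselect (family_stratum b y); last by exists 0.
  by exists M.
have YM y : family_stratum b y -> row_free (M y) /\ rho_stable form (mats y) (M y).
  by move=> /HM[sty /family_lagrangian[]].
have [U UU [UY [R [N [h [plR RN fN stN UN]]]]]] := rho_stable_limit clA YM.
have algR := place_alg plR.
have lagN : lagrangian G (N None).
  split=> //; rewrite -mulmxA.
  apply: (limit_mulmx_eq0 (B := fun o => G *m (N o)^T) UU plR RN).
    by apply: (entrywise_mul algR);
      [exact: entrywise_cst | exact: entrywise_tr].
  apply: filterS2 UY UN => y /HM[_ /family_lagrangian lagM] [_ EN] /=.
  by have [_] := lagrangian_eqmx (eqmx_sym EN) lagM; rewrite mulmxA.
have [L L0 LN] := lagrangian_complement two_neq0 G_unit G_sym lagN.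
have [y [Yy [EN dL]]] : exists y, family_stratum b y /\
    ((N (Some y) :=: M y)%MS /\ \det (L *m G *m (N (Some y))^T) != 0).
  apply: contrapT => Ny.
  have : \det (L *m G *m (N None)^T) = 0.
    apply: (place_consistent plR (f := fun o => \det (L *m G *m (N o)^T))).
      apply: (fun_det algR); apply: (entrywise_mul algR);
        first exact: entrywise_cst.
      exact: entrywise_tr.
    apply: filterS2 UY UN => y Yy [_ EN] /=; apply/eqP.
    by apply: contrapT => /negP dL; apply: Ny; exists y.
  by rewrite LN det1 => /eqP; rewrite oner_eq0.
have [sty Fy] := HM y Yy.
have BU : L *m G *m (N (Some y))^T \in unitmx by rewrite unitmxE unitfE.
(* rescale the basis of W_y so that it becomes dual to L *)
set B := L *m G *m _ in BU; pose N' := invmx B^T *m N (Some y).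
have EN' : (N' :=: M y)%MS.
  apply: eqmx_trans EN; apply: eqmxMfull.
  by rewrite row_full_unit unitmx_inv unitmx_tr.
have [fN' N'0] := lagrangian_eqmx (eqmx_sym EN') (family_lagrangian Fy).
have LN' : L *m G *m N'^T = 1%:M.
  by rewrite trmx_mul trmx_inv trmxK mulmxA -/B mulmxV.
have [g [gG dg Ng]] := isometry_of_frames two_neq0 G_unit G_sym
  (conj fN' N'0) lagN.2 L0 LN' LN.
exists (N None); split=> //; apply: (family_move gG dg _ Fy).
by rewrite -Ng; apply: eqmxMr; apply: eqmx_sym.
Qed.

(** A tuple of regular nilpotent matrices remembers the Lagrangian it was
    built from, and so its family. *)
Lemma family_stratum_sub b b' : family_stratum b `<=` family_stratum b' -> b = b'.
Proof.
move=> sub; have [M FM] := family_nonempty b; have lagM := family_lagrangian FM.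
have [X MX Xuniq] := nilpotent_with_unique_subspace two_neq0 G_unit G_sym lagM.
have [|N [stN FN]] := sub (of_matrices (fun=> X)).
  exists M; split=> //; rewrite mats_of_matrices => i; split=> //.
  apply: (lagrangian_perp two_neq0 G_unit G_sym lagM).
  have /submxP[a Ma] := MX.
  rewrite /adjmx !mulmxA mulmxKV // -(mulmxA (M *m G)) -trmx_mul Ma trmx_mul mulmxA.
  by have [_ ->] := lagM; rewrite mul0mx.
move: stN; rewrite mats_of_matrices => /(_ (Ordinal r_gt0))[NX _].
have ENM := Xuniq N (family_lagrangian FN).1 NX.
apply: family_disjoint FM _.
apply: (family_move (isometry1 G) (det1 _ _) _ FN).
by rewrite mulmx1.
Qed.

Lemma lagrangian_stratumE : Zeq form d d r = family_stratum false `|` family_stratum true.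
Proof.
apply/seteqP; split=> [A /Zeq_subspace[//|M [fM stM rkM]]|A YA].
  have M0 : M *m G *m M^T = 0.
    by apply/eqP; rewrite -mxrank_eq0 -(eqn_add2r d) rkM add0n.
  have [b Fb] := lagrangian_family (conj fM M0).
  by case: b Fb => Fb; [right | left]; exists M.
split; last exact: Zge_gtd.
apply/ZgeP => //.
have [b [M [stM FM]]] : exists b, family_stratum b A.
  by case: YA => YA; [exists false | exists true].
have [fM M0] := family_lagrangian FM.
by exists M; rewrite M0 mxrank0.
Qed.

(** A set covered by two closed irreducible sets, neither of which contains
    the other. *)
Lemma irreducible_components_of_two (Y : bool -> set T) Z : Z = Y false `|` Y true ->
  (forall b, irreducible (Y b)) -> (forall b, zariski_closed (Y b)) ->
  (forall b b', Y b `<=` Y b' -> b = b') ->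
  Y false <> Y true /\
  [set C | irreducible_component Z C] = [set Y false; Y true].
Proof.
move=> EZ irrY clY subY; split.
  by move=> E; have := subY false true; rewrite E => /(_ (@subset_refl _ _)).
have sYZ b : Y b `<=` Z by rewrite EZ; case: b => ? ?; [right | left].
have irr_sub C : C `<=` Z -> irreducible C -> exists b, C `<=` Y b.
  move=> sCZ [_ irrC].
  have EC : C = (C `&` Y false) `|` (C `&` Y true).
    apply/seteqP; split=> [A CA|A [[]|[]]//].
    by have := sCZ A CA; rewrite EZ => -[?|?]; [left | right].
  have clC b : zariski_closed_in C (C `&` Y b) by exists (Y b).
  have [E|E] := irrC _ _ (clC false) (clC true) EC.
    by exists false => A CA; rewrite E in CA; case: CA.
  by exists true => A CA; rewrite E in CA; case: CA.
apply/seteqP; split=> [C [sCZ irrC maxC]|C].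
  have [b sCY] := irr_sub C sCZ irrC.
  by rewrite -(maxC (Y b) (sYZ b) (irrY b) sCY); case: b {sCY}; [right | left].
suff comp b : irreducible_component Z (Y b) by case=> ->; apply: comp.
split=> // Y' sY'Z irrY' sYY'.
have [b' sY'b] := irr_sub Y' sY'Z irrY'.
have Eb : b = b' by apply: subY; apply: subset_trans sYY' sY'b.
by apply/seteqP; split; rewrite ?Eb // -?Eb.
Qed.

End LagrangianStratum.

(** * The irreducible components of the stratum *)

Theorem proposition3p14 (k : closedFieldType) (char_k : 2%N \notin [pchar k])
  (n r : nat) (n_gt0 : (0 < n)%N) (r_gt0 : (0 < r)%N)
  (eps : bool) (form : {hermitian 'rV[k]_n for eps & idfun})
  (form_nondeg : nondegenerate form)
  (d l : nat) (d_bounds : (1 <= d <= n - 1)%N) (l_bounds : (0 <= l <= d)%N)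
  (Z_nonempty : Zeq form l d r !=set0) :
  let exceptional := [/\ eps = false, (2 * d)%N = n & l = d] in
  (~ exceptional -> irreducible (Zeq form l d r)) /\
  (exceptional ->
    exists Y1 Y2 : set {ffun 'I_r -> 'End('rV[k]_n)},
      Y1 <> Y2 /\
      [set Y | irreducible_component (Zeq form l d r) Y] = [set Y1; Y2]).
Proof.
move=> exceptional.
have two_neq0 : 2%:R != 0 :> k by apply: contra char_k => /eqP E; rewrite inE /= E.
split=> [Nexc|[eps0 dn ld]].
  exact: (Zeq_irreducible two_neq0 form_nondeg l_bounds Z_nonempty Nexc).
have d_gt0 : (0 < d)%N by case/andP: d_bounds.
have En : n = (d + d)%N by rewrite -dn mul2n addnn.
clear exceptional dn; subst n eps l.
have [A ZA] := Z_nonempty.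
have [M [fM _ rkM]] := Zeq_subspace (leqnn d) ZA.
have lagM : lagrangian (matrix_of_form form) M.
  by split=> //; apply/eqP; rewrite -mxrank_eq0 -(eqn_add2r d) rkM add0n.
exists (@family_stratum k d r form M false), (@family_stratum k d r form M true).
apply: irreducible_components_of_two => [|b|b|b b'].
- exact: lagrangian_stratumE.
- exact: family_stratum_irreducible.
- exact: family_stratum_closed.
exact: family_stratum_sub.
Qed.
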